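(* Let $(\kappa_n)_{n\ge1}$ be a collection of classes with $\kappa_n\in H^1(K[m],M\otimes\Lambda_n(\bm{\kappa}_{\textup{ac}}^{-1}))$ for all $n$, such that \[ \mathrm{pr}^n_{n-1}\kappa_n=a_p(g)\,\kappa_{n-1}-\chi_g(p)\operatorname{Tr}^{n-1}_{n-2}\kappa_{n-2}\qquad\text{for all }n\ge3. \] Then there exist unique $\kappa_\sharp,\kappa_\flat\in H^1(K[m],M\otimes\Lambda(\bm{\kappa}_{\textup{ac}}^{-1}))$ such that for all $n\ge2$ \[ \begin{bmatrix}\kappa_n\\-\chi_g(p)\operatorname{Tr}^n_{n-1}\kappa_{n-1}\end{bmatrix}=C_{g,n-1}\cdots C_{g,1}\begin{bmatrix}\mathrm{pr}^\infty_n\kappa_\sharp\\ \mathrm{pr}^\infty_n\kappa_\flat\end{bmatrix}. \]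
   Context: Let $p$ be an odd prime, $K$ an imaginary quadratic field in which $p$ splits with $p$ not dividing its class number; $m$ a square-free product of primes coprime to $Np$ split in $K$ ($N$ a fixed integer prime to $p$); $K[m]$ the maximal $p$-subextension of the ring class field of conductor $m$. Let $L/\mathbb{Q}_p$ be finite with integers $\mathcal{O}$, maximal ideal $\mathfrak{P}$. $\Gamma_{\textup{ac}}$ is the Galois group of the anticyclotomic $\mathbb{Z}_p$-extension of $K$, identified with the anti-diagonal of $(1+p\mathbb{Z}_p)^2\cong\mathcal{O}_{K,\mathfrak{p}}^{(1)}\times\mathcal{O}_{K,\overline{\mathfrak{p}}}^{(1)}$; $\Lambda=\mathcal{O}[[1+p\mathbb{Z}_p]]=\mathcal{O}[[X]]$ via $[1+p]\mapsto1+X$; $\bm{\kappa}_{\textup{ac}}:\Gamma_{\textup{ac}}\to\Lambda^\times$ sends $((1+p)^{-1},1+p)$ to $[1+p]$. For $n\ge1$, $\Lambda_n=\mathcal{O}[(1+p\mathbb{Z}_p)/(1+p^n\mathbb{Z}_p)]=\Lambda/(\omega_{n-1})$, $\omega_k=(1+X)^{p^k}-1$; $\mathrm{pr}^{n'}_n$, $\mathrm{pr}^\infty_n$ are the natural projections and $\operatorname{Tr}^{n'}_n:\Lambda_n\to\Lambda_{n'}$ sends a group element $\sigma$ to the sum of its preimages; same notation on cohomology. $M=T_f^*\otimes_{\mathcal{O}}T_g^*(\varphi_{0,\mathfrak{P}}^c)(2)$ where $T_f^*,T_g^*$ are $G_{\mathbb{Q}}$-stable lattices in the Galois representations of weight-two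 eigenforms $f,g$, $\varphi_{0,\mathfrak{P}}$ is the $p$-adic avatar of a Hecke character of $K$ of infinity type $(-1,0)$ and conductor dividing $\mathfrak{c}\mathfrak{p}$, $(\mathfrak{c},p)=1$, and $c$ is complex conjugation; $G_{K[m]}$ acts on $\Lambda_n$, $\Lambda$ via $\bm{\kappa}_{\textup{ac}}^{-1}$. Here $a_p(g)\in\mathcal{O}$ is the $p$-th Hecke eigenvalue of $g$ and $\chi_g$ its nebentypus. For $n\ge1$, $\Phi_n=\sum_{j=0}^{p-1}(1+X)^{jp^{n-1}}$ and $C_{g,n}=\begin{bmatrix}a_p(g)&1\\-\chi_g(p)\Phi_n&0\end{bmatrix}\in M_2(\Lambda)$, acting on pairs of classes with coefficients in $\Lambda_n$ through $\Lambda\to\Lambda_n$. Standing assumption: $H^0(K,M/\mathfrak{P}M)=0$.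
   Formalization: The formal theorem also assumes that g is non-ordinary at p, i.e. a_p(g) lies in the maximal ideal of O; if a_p(g) is a unit, uniqueness of the pair κ_♯, κ_♭ always fails (already for κ_n = 0). *)

(* Defs.v *)
From HB Require Import structures.
From mathcomp Require Import all_boot all_order all_fingroup all_algebra all_field.
From mathcomp Require Import complex.
From mathcomp Require Import all_classical all_reals all_analysis.

Set Implicit Arguments.
Unset Strict Implicit.
Unset Printing Implicit Defensive.

Import Order.TTheory GRing.Theory Num.Theory.
Import numFieldNormedType.Exports.

Local Open Scope classical_set_scope.
Local Open Scope ring_scope.

(* The absolute Galois group of Q. Every ring endomorphism of algC is
   bijective, since algC is algebraic over Q. *)
Notation GQ := {rmorphism algC -> algC}.

Definition gal_mul (s t : GQ) : GQ := s \o t.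
Definition gal_one : GQ := idfun.
Definition complex_conj : GQ := @Num.conj algC.

Definition fixer (F : set algC) : set GQ :=
  [set s | forall x, F x -> s x = x].

(* Continuity on G for the Krull topology; nb is a neighbourhood base of 0
   consisting of subgroups. *)
Definition krull_continuous (A : zmodType) (nb : nat -> set A) (G : set GQ)
    (c : GQ -> A) : Prop :=
  forall k s, G s -> exists X : seq algC,
    forall t, G t -> {in X, s =1 t} -> nb k (c t - c s).

Definition is_subfield (F : set algC) : Prop :=
  [/\ F 1, forall x y, F x -> F y -> F (x - y),
      forall x y, F x -> F y -> F (x * y) & forall x, F x -> F x^-1].

(* F/K is a finite Galois extension with n automorphisms. *)
Definition galois_ext (K F : set algC) (n : nat) : Prop :=
  [/\ is_subfield F, K `<=` F,
      forall s x, fixer K s -> F x -> F (s x) &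
      exists g : 'I_n -> GQ,
        [/\ forall i, fixer K (g i),
            forall i j, (forall x, F x -> g i x = g j x) -> i = j &
            forall s, fixer K s ->
              exists i, forall x, F x -> s x = g i x]].

Definition p_extension (p : nat) (K F : set algC) : Prop :=
  exists k, galois_ext K F (p ^ k).

Definition is_max_p_subextension (p : nat) (K H F : set algC) : Prop :=
  [/\ p_extension p K F, F `<=` H &
      forall F', p_extension p K F' -> F' `<=` H -> F' `<=` F].

Definition Zbar : set algC := [set x | x \in Aint].

Definition is_ideal (A I : set algC) : Prop :=
  [/\ I `<=` A, I 0, forall x y, I x -> I y -> I (x + y) &
      forall a x, A a -> I x -> I (a * x)].

Definition nonzero_ideal (A I : set algC) : Prop :=
  is_ideal A I /\ exists2 x, I x & x != 0.

Definition nonzero_prime (A q : set algC) : Prop :=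
  [/\ nonzero_ideal A q, ~ q 1 &
      forall x y, A x -> A y -> q (x * y) -> q x \/ q y].

Definition residue_card (A I : set algC) (n : nat) : Prop :=
  exists r : 'I_n -> algC,
    [/\ forall i, A (r i), forall i j, I (r i - r j) -> i = j &
        forall x, A x -> exists i, I (x - r i)].

Definition ideal_mul (I J : set algC) : set algC :=
  [set x | exists n (a b : 'I_n -> algC),
     [/\ forall i, I (a i), forall i, J (b i) & x = \sum_i a i * b i]].

(* The first argument is the unit ideal. *)
Definition ideal_pow (A I : set algC) (k : nat) : set algC :=
  iter k (ideal_mul I) A.

Definition principal (A : set algC) (a : algC) : set algC :=
  [set a * x | x in A].

Definition coprime_ideals (I J : set algC) : Prop :=
  exists x y, [/\ I x, J y & x + y = 1].

(* For s in G_Q and Q a nonzero prime of Zbar; an arithmetic Frobenius induces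
   x |-> x ^ n on Zbar/Q and a geometric one induces the inverse. *)
Definition arith_frob (Q : set algC) (n : nat) (s : GQ) : Prop :=
  forall x, Zbar x -> Q (s x - x ^+ n).
Definition geom_frob (Q : set algC) (n : nat) (s : GQ) : Prop :=
  forall x, Zbar x -> Q (x - s x ^+ n).
Definition inertia (Q : set algC) : set GQ :=
  [set s | forall x, Zbar x -> Q (s x - x)].

Definition square_free (n : nat) : Prop :=
  (0 < n)%N /\ forall l, prime l -> ~~ (l ^ 2 %| n)%N.

Definition QK (d : nat) : set algC :=
  [set x | exists a b : rat, x = ratr a + ratr b * sqrtC (- d%:R)].

Definition OK (d : nat) : set algC := QK d `&` Zbar.

Definition GK (d : nat) : set GQ := fixer (QK d).

Definition splits (d l : nat) : Prop :=
  exists q1 q2 : set algC,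
    [/\ nonzero_prime (OK d) q1, nonzero_prime (OK d) q2,
        q1 l%:R, q2 l%:R & q1 <> q2].

Definition ideal_equiv (d : nat) (I J : set algC) : Prop :=
  exists a b, [/\ OK d a, OK d b, a != 0, b != 0 &
                  [set a * x | x in I] = [set b * x | x in J]].

Definition class_number (d h : nat) : Prop :=
  exists t : 'I_h -> set algC,
    (forall i, nonzero_ideal (OK d) (t i)) /\
    (forall J, nonzero_ideal (OK d) J -> exists! i, ideal_equiv d J (t i)).

(* Q is a prime of Zbar above the prime q of K, of norm n. *)
Definition above (d : nat) (Q q : set algC) (n : nat) : Prop :=
  [/\ nonzero_prime Zbar Q, nonzero_prime (OK d) q, Q `&` OK d = q &
      residue_card (OK d) q n].

(* The integral ideals lying in the subgroup P_{K,Z}(m) generated by the a O_K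
   with a congruent mod m O_K to a rational integer prime to m. *)
Definition ring_class_principal (d m : nat) (I : set algC) : Prop :=
  exists (a : algC) (c : nat),
    [/\ OK d a, I = principal (OK d) a, coprime c m &
        principal (OK d) m%:R (a - c%:R)].

(* The extension of K attached by class field theory to P_{K,Z}(m): the
   kernel of the Artin map on ideals prime to m is P_{K,Z}(m). *)
Definition is_ring_class_field (d m : nat) (H : set algC) : Prop :=
  (exists n, galois_ext (QK d) H n) /\
  exists art : set algC -> GQ,
    let prime_to_m I := nonzero_ideal (OK d) I /\
                        coprime_ideals I (principal (OK d) m%:R) in
    [/\ forall I, prime_to_m I -> GK d (art I),
        forall I J, prime_to_m I -> prime_to_m J ->
          forall x, H x -> art (ideal_mul I J) x = art I (art J x),
        forall Q q n s, prime_to_m q -> above d Q q n ->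
          GK d s -> arith_frob Q n s -> forall x, H x -> art q x = s x &
        forall I, prime_to_m I ->
          ((forall x, H x -> art I x = x) <-> ring_class_principal d m I)].

Definition adic (O : pzRingType) (pi : O) (V : lmodType O) (k : nat) : set V :=
  [set x | exists y : V, x = pi ^+ k *: y].

(* O is a complete discrete valuation ring of characteristic 0 with uniformizer
   pi and finite residue field of characteristic p. These are exactly the rings
   of integers of the finite extensions L of Q_p; then L is the fraction field
   of O and the maximal ideal is (pi). *)
Record padic_integers (p : nat) (O : idomainType) (pi : O) : Prop := {
  pi_neq0 : pi != 0;
  pi_nonunit : pi \isn't a GRing.unit;
  pi_uniformizer : forall x : O, x != 0 ->
    exists u k, u \is a GRing.unit /\ x = u * pi ^+ k;
  pi_complete : forall x : nat -> O,
    (forall n, adic pi (V := O^o) n (x n.+1 - x n)) ->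
    exists y, forall n, adic pi (V := O^o) n (y - x n);
  finite_residue_field : exists r : seq O, forall x,
    exists2 y, y \in r & adic pi (V := O^o) 1 (x - y);
  char0 : [pchar O] =i pred0;
  residue_char : adic pi (V := O^o) 1 p%:R
}.

(* e is a ring embedding into O of a subring E of Zbar containing O_K, i.e. the
   restriction to E of an embedding of Frac(E) into L. *)
Record is_embedding (d : nat) (O : idomainType) (E : set algC)
    (e : algC -> O) : Prop := {
  E_integral : E `<=` Zbar;
  E_OK : OK d `<=` E;
  E_sub : forall x y, E x -> E y -> E (x - y);
  E_mul : forall x y, E x -> E y -> E (x * y);
  e_one : e 1 = 1;
  e_sub : forall x y, E x -> E y -> e (x - y) = e x - e y;
  e_mul : forall x y, E x -> E y -> e (x * y) = e x * e y
}.

(* The prime of K above p singled out by e; the other one is its conjugate. *)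
Definition frakp (d : nat) (O : idomainType) (pi : O) (e : algC -> O) :
    set algC := OK d `&` [set x | adic pi (V := O^o) 1 (e x)].

Record dirichlet_char (N : nat) (chi : int -> algC) : Prop := {
  chi_period : forall x, chi (x + N%:Z) = chi x;
  chi_mul : forall x y, chi (x * y) = chi x * chi y;
  chi_support : forall x, (chi x != 0) = coprimez x N%:Z
}.

Section Eigenforms.
Variables (R : realType) (iota : {rmorphism algC -> R[i]}).

Definition cvgC (u : nat -> R[i]) (z : R[i]) : Prop :=
  ((fun n => complex.Re (u n)) @ \oo --> complex.Re z) /\
  ((fun n => complex.Im (u n)) @ \oo --> complex.Im z).

(* exp(2 pi i n tau) *)
Definition qpow (n : nat) (tau : R[i]) : R[i] :=
  let t := 2 * pi * n%:R in
  (expR (- (t * complex.Im tau)))%:C%C *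
    Complex (cos (t * complex.Re tau)) (sin (t * complex.Re tau)).

(* F is the sum of the q-expansion with coefficients a, transforms with weight
   2 and character chi under Gamma_0(N), and Im(tau)|F(tau)| is bounded on the
   upper half-plane; the last condition is vanishing at all cusps. *)
Record is_cusp_form2 (N : nat) (chi : int -> algC) (a : nat -> algC)
    (F : R[i] -> R[i]) : Prop := {
  mf_qexp : forall tau, 0 < complex.Im tau ->
    cvgC (fun n => \sum_(k < n) iota (a k) * qpow k tau) (F tau);
  mf_modular : forall (a b c d : int) tau, 0 < complex.Im tau ->
    a * d - b * c = 1 -> (N%:Z %| c)%Z ->
    F ((a%:~R * tau + b%:~R) / (c%:~R * tau + d%:~R)) =
      iota (chi d) * (c%:~R * tau + d%:~R) ^+ 2 * F tau;
  mf_cusp : exists B : R, forall tau, 0 < complex.Im tau ->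
    complex.Im tau * complex.Re `|F tau| <= B
}.

(* a is the sequence of q-expansion coefficients of a normalized cuspidal
   eigenform of weight 2, level N and nebentypus chi; a l is the eigenvalue of
   T_l (of U_l if l divides N, where chi l = 0). *)
Record is_eigenform2 (N : nat) (chi : int -> algC) (a : nat -> algC) :
    Prop := {
  ef_level : (0 < N)%N;
  ef_char : dirichlet_char N chi;
  ef_form : exists F, is_cusp_form2 N chi a F;
  ef_normalized : a 1%N = 1;
  ef_hecke : forall l n, prime l ->
    a (l * n)%N + (if (l %| n)%N then chi l%:Z * l%:R * a (n %/ l)%N else 0)
      = a l * a n
}.

End Eigenforms.

Section GaloisRepresentations.
Variables (p d : nat) (O : idomainType) (pi : O) (e : algC -> O).

(* rho is a lattice T_f^*, in a basis: geometric Frobenius at l has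
   characteristic polynomial X^2 - a_l X + l chi(l). By Chebotarev and
   Brauer-Nesbitt this determines rho over L. *)
Record is_lattice_of (N : nat) (chi : int -> algC) (a : nat -> algC)
    (rho : GQ -> 'M[O]_2) : Prop := {
  rho_one : rho gal_one = 1%:M;
  rho_mul : forall s t, rho (gal_mul s t) = rho s *m rho t;
  rho_cont : krull_continuous (adic pi (V := 'M[O]_2)) setT rho;
  rho_unramified : forall l Q s, prime l -> ~~ (l %| N * p)%N ->
    nonzero_prime Zbar Q -> Q l%:R -> inertia Q s -> rho s = 1%:M;
  rho_frob : forall l Q s, prime l -> ~~ (l %| N * p)%N ->
    nonzero_prime Zbar Q -> Q l%:R -> geom_frob Q l s ->
    char_poly (rho s) = 'X^2 - (e (a l))%:P * 'X + (e (chi l%:Z * l%:R))%:P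
}.

(* A Hecke character of K modulo c frakp and of infinity type (-1,0), as a
   character of ideals. *)
Record is_hecke_char (c : set algC) (phi0 : set algC -> algC) : Prop := {
  hc_modulus : nonzero_ideal (OK d) c /\
    coprime_ideals c (principal (OK d) p%:R);
  hc_neq0 : forall I, nonzero_ideal (OK d) I ->
    coprime_ideals I (ideal_mul c (frakp d pi e)) -> phi0 I != 0;
  hc_mul : forall I J, nonzero_ideal (OK d) I -> nonzero_ideal (OK d) J ->
    coprime_ideals I (ideal_mul c (frakp d pi e)) ->
    coprime_ideals J (ideal_mul c (frakp d pi e)) ->
    phi0 (ideal_mul I J) = phi0 I * phi0 J;
  hc_infinity_type : forall a, OK d a -> a != 0 ->
    ideal_mul c (frakp d pi e) (a - 1) -> phi0 (principal (OK d) a) = a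
}.

Record is_padic_avatar (c : set algC) (phi0 : set algC -> algC)
    (phi : GQ -> O) : Prop := {
  av_one : phi gal_one = 1;
  av_mul : forall s t, GK d s -> GK d t -> phi (gal_mul s t) = phi s * phi t;
  av_cont : krull_continuous (adic pi (V := O^o)) (GK d) phi;
  av_frob : forall Q q n s, above d Q q n -> coprime_ideals q c ->
    ~ q p%:R -> GK d s -> geom_frob Q n s -> phi s = e (phi0 q)
}.

Definition is_cyclotomic (cyc : GQ -> O) : Prop :=
  forall (s : GQ) n (z : algC), z ^+ (p ^ n) = 1 ->
    exists k, s z = z ^+ k /\ adic (p%:R : O) (V := O^o) n (cyc s - k%:R).

Definition twist_conj (phi : GQ -> O) (s : GQ) : O :=
  phi (gal_mul complex_conj (gal_mul s complex_conj)).

(* T_f^* (x) T_g^* (phi^c)(2) is realized on 2 x 2 matrices: v (x) w is the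
   matrix v w^T. *)
Definition M_act (rhof rhog : GQ -> 'M[O]_2) (phi cyc : GQ -> O) (s : GQ)
    (A : 'M[O]_2) : 'M[O]_2 :=
  (twist_conj phi s * cyc s ^+ 2) *: (rhof s *m A *m (rhog s)^T).

Lemma M_act_is_linear rhof rhog phi cyc s :
  linear (M_act rhof rhog phi cyc s).
Proof.
move=> a A B; rewrite /M_act mulmxDr mulmxDl -scalemxAr -scalemxAl scalerDr.
by rewrite !scalerA mulrC.
Qed.

HB.instance Definition _ rhof rhog phi cyc s :=
  GRing.isLinear.Build O 'M[O]_2 'M[O]_2 *:%R (M_act rhof rhog phi cyc s)
    (M_act_is_linear rhof rhog phi cyc s).

Definition M_rep (rhof rhog : GQ -> 'M[O]_2) (phi cyc : GQ -> O) (s : GQ) :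
  {linear 'M[O]_2 -> 'M[O]_2} := M_act rhof rhog phi cyc s.

(* H^0(G, V / pi V) = 0 *)
Definition residual_H0_trivial (V : lmodType O) (G : set GQ)
    (act : GQ -> V -> V) : Prop :=
  forall x, (forall s, G s -> adic pi (V := V) 1 (act s x - x)) ->
    adic pi (V := V) 1 x.

End GaloisRepresentations.

Section OneUnits.
Variables (p : nat) (p_prime : prime p).

(* 1 + pZ_p modulo 1 + p^n Z_p. The exponent is n for n >= 1, and the case
   n = 0 duplicates n = 1. *)
Definition one_units_set (n : nat) : {set {unit 'Z_(p ^ n.-1.+1)}} :=
  [set u | (val (val u : 'Z_(p ^ n.-1.+1)) == 1 %[mod p])%N].

Lemma level_gt1 n : (1 < p ^ n.-1.+1)%N.
Proof. by rewrite -{1}(exp1n n.-1.+1) ltn_exp2r // prime_gt1. Qed.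

Lemma one_units_group_set n : group_set (one_units_set n).
Proof.
have pN : (p %| (Zp_trunc (p ^ n.-1.+1)).+2)%N.
  by rewrite Zp_cast ?level_gt1 // expnS dvdn_mulr.
apply/group_setP; split=> [|u v]; rewrite !inE //= => /eqP Hu /eqP Hv.
by apply/eqP; rewrite modn_dvdm // -modnMm Hu Hv modnMm muln1.
Qed.
Canonical one_units_group n := Group (one_units_group_set n).

Definition U (n : nat) : finGroupType := [subg one_units_group n].

Definition u_val (n : nat) (u : U n) : nat :=
  val (val (sgval u) : 'Z_(p ^ n.-1.+1)).

Definition u_of_nat (n k : nat) : U n :=
  subg (one_units_group n) (insubd (1%g : {unit 'Z_(p ^ n.-1.+1)}) (inZp k)).

Definition u_red (n : nat) (u : U n.+1) : U n := u_of_nat n (u_val u).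

Definition u_gen (n : nat) : U n := u_of_nat n p.+1.

Lemma u_val_inj n : injective (@u_val n).
Proof. by move=> u v /val_inj/val_inj/val_inj. Qed.

Lemma u_val_lt n (u : U n) : (u_val u < p ^ n.-1.+1)%N.
Proof. by apply: leq_trans (ltn_ord _) _; rewrite Zp_cast ?level_gt1. Qed.

Lemma u_valP n (u : U n) : (u_val u == 1 %[mod p])%N.
Proof. by move: (subgP u); rewrite inE. Qed.

Lemma u_val_mul n (u v : U n) :
  u_val (u * v)%g = (u_val u * u_val v %% p ^ n.-1.+1)%N.
Proof. exact: (congr1 (modn _) (Zp_cast (level_gt1 n))). Qed.

Lemma u_of_natK n k : (k == 1 %[mod p])%N ->
  u_val (u_of_nat n k) = (k %% p ^ n.-1.+1)%N.
Proof.
move=> k1; have pk : coprime (p ^ n.-1.+1) k.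
  rewrite coprimeXl // prime_coprime //; apply/negP=> /dvdnP [j Ej].
  by move: k1; rewrite Ej modnMl modn_small ?prime_gt1.
have kU : (inZp k : 'Z_(p ^ n.-1.+1)) \is a GRing.unit.
  by rewrite -Zp_nat unitZpE ?level_gt1.
have ku : val (inZp k : 'Z_(p ^ n.-1.+1)) = (k %% p ^ n.-1.+1)%N.
  by rewrite /= Zp_cast ?level_gt1.
rewrite /u_val /u_of_nat subgK ?val_insubd ?kU //.
rewrite inE val_insubd kU ku modn_dvdm ?(eqP k1) //.
by rewrite expnS dvdn_mulr.
Qed.

Lemma u_red_val n (u : U n.+1) : u_val (u_red u) = (u_val u %% p ^ n.-1.+1)%N.
Proof. by rewrite u_of_natK ?u_valP. Qed.

Lemma u_redM n : {morph @u_red n : u v / (u * v)%g}.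
Proof.
move=> u v; apply: u_val_inj; rewrite u_val_mul !u_red_val u_val_mul modn_dvdm.
  by rewrite modnMm.
by rewrite dvdn_exp2l //; case: n {u v}.
Qed.

Lemma u_mulC n (u v : U n) : (u * v = v * u)%g.
Proof. by apply: u_val_inj; rewrite !u_val_mul mulnC. Qed.

(* 1 + pZ_p as the inverse limit of the U n. *)
Record oneZp := OneZp {
  oz_comp :> forall n, U n;
  oz_compat : forall n, u_red (oz_comp n.+1) = oz_comp n
}.

End OneUnits.

(* kac is the character G_K -> Gamma_ac -> 1 + pZ_p, with Gamma_ac identified
   by reciprocity with the anti-diagonal of (1+pZ_p)^2 (the factors being
   frakp and its conjugate, uniformizers mapping to geometric Frobenii), and
   (x^-1, x) sent to x; thus (u, v) in (1+pZ_p)^2 goes to (v/u)^(1/2).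
   If q^k = (a) then Frob_q^k corresponds to the component at p of 1/a, namely
   (1/e(a), 1/e(conj a)), whence kac(Frob_q)^(2k) = e(a)/e(conj a) up to roots
   of unity of order dividing p - 1. By Chebotarev this determines kac. *)
Record is_anticyclotomic (d p : nat) (p_prime : prime p) (O : idomainType)
    (e : algC -> O) (kac : GQ -> oneZp p_prime) : Prop := {
  kac_mul : forall n s t, GK d s -> GK d t ->
    kac (gal_mul s t) n = (kac s n * kac t n)%g;
  kac_cont : forall n s, GK d s -> exists X : seq algC,
    forall t, GK d t -> {in X, s =1 t} -> kac t n = kac s n;
  kac_frob : forall Q q nq s k a n, above d Q q nq -> ~ q p%:R ->
    GK d s -> geom_frob Q nq s -> (0 < k)%N -> OK d a ->
    ideal_pow (OK d) q k = principal (OK d) a -> (0 < n)%N ->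
    adic (p%:R : O) (V := O^o) n
      ((u_val (kac s n))%:R ^+ (2 * k * p.-1) * e (a^*) ^+ p.-1
       - e a ^+ p.-1)
}.

(* An abelian group with a linear topology and an operation of G_Q by
   endomorphisms. The laws of a group action are not imposed here: in the
   intended modules they hold for elements of G_K only. *)
Record gmodule := GModule {
  gm_sort :> zmodType;
  gm_nbhs : nat -> set gm_sort;
  gm_act : GQ -> gm_sort -> gm_sort;
  gm_nbhs0 : forall k, gm_nbhs k 0;
  gm_nbhsB : forall k x y, gm_nbhs k x -> gm_nbhs k y -> gm_nbhs k (x - y);
  gm_actB : forall s x y, gm_act s (x - y) = gm_act s x - gm_act s y
}.

Record ghom (A B : gmodule) := GHom {
  gh_fun :> A -> B;
  ghB : forall x y, gh_fun (x - y) = gh_fun x - gh_fun y;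
  gh_act : forall s x, gh_fun (gm_act s x) = gm_act s (gh_fun x);
  gh_cont : forall k, exists l,
    forall x, @gm_nbhs A l x -> @gm_nbhs B k (gh_fun x)
}.

Section Cohomology.
Variables (G : set GQ) (A : gmodule).

(* Cochains are functions on all of G_Q of which only the restriction to G is
   used; coboundaries are tested on G. *)
Definition is_cocycle (c : GQ -> A) : Prop :=
  (forall s t, G s -> G t -> c (gal_mul s t) = c s + gm_act s (c t)) /\
  krull_continuous (@gm_nbhs A) G c.

Definition Z1_pred : {pred (GQ -> A)} := [pred c | `[< is_cocycle c >]].

Lemma Z1_pred_closed : zmod_closed Z1_pred.
Proof.
split=> [|c c' /asboolP [cM cC] /asboolP [cM' cC']]; apply/asboolP; split.
- move=> s t _ _; change ((0 : A) = 0 + gm_act s (0 : A)).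
  by rewrite -[X in gm_act _ X](subrr (0 : A)) gm_actB subrr addr0.
- move=> k s _; exists [::] => t _ _; change (gm_nbhs k ((0 : A) - 0)).
  by rewrite subrr; apply: gm_nbhs0.
- move=> s t Gs Gt; change (c (gal_mul s t) - c' (gal_mul s t) =
    (c s - c' s) + gm_act s (c t - c' t)).
  by rewrite cM // cM' // gm_actB opprD addrACA.
- move=> k s Gs; have [X cX] := cC k s Gs; have [Y cY] := cC' k s Gs.
  exists (X ++ Y) => t Gt st.
  change (gm_nbhs k ((c t - c' t) - (c s - c' s))).
  have -> : (c t - c' t) - (c s - c' s) = (c t - c s) - (c' t - c' s).
    by rewrite !opprD !opprK addrACA.
  apply: gm_nbhsB.
  - by apply: cX => // x xX; apply: st; rewrite mem_cat xX.
  - by apply: cY => // x xY; apply: st; rewrite mem_cat xY orbT.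
Qed.

HB.instance Definition _ :=
  GRing.isZmodClosed.Build (GQ -> A) Z1_pred Z1_pred_closed.

Record Z1 := MkZ1 { z1_fun :> GQ -> A; z1P : z1_fun \in Z1_pred }.
HB.instance Definition _ := [isSub for z1_fun].
HB.instance Definition _ := [Choice of Z1 by <:].
HB.instance Definition _ := [SubChoice_isSubZmodule of Z1 by <:].

Definition is_coboundary (c : GQ -> A) : Prop :=
  exists a : A, forall s, G s -> c s = gm_act s a - a.

Definition B1 : {pred Z1} := [pred c : Z1 | `[< is_coboundary c >]].

Lemma B1_closed : zmod_closed B1.
Proof.
split=> [|c c' /asboolP [a ca] /asboolP [a' ca']]; apply/asboolP.
  exists 0 => s _; change ((0 : A) = gm_act s 0 - 0).
  by rewrite -[X in gm_act _ X](subrr (0 : A)) gm_actB !subrr.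
exists (a - a') => s Gs; change (c s - c' s = gm_act s (a - a') - (a - a')).
by rewrite ca // ca' // gm_actB !opprD !opprK addrACA.
Qed.

HB.instance Definition _ := GRing.isZmodClosed.Build Z1 B1 B1_closed.

Definition H1 : zmodType := {ideal_quot (B1 : zmodClosed Z1)}.

Definition H1_class (c : Z1) : H1 :=
  (\pi_({ideal_quot (B1 : zmodClosed Z1)}) c)%qT.
Definition H1_repr (x : H1) : Z1 :=
  generic_quotient.repr (x : {ideal_quot (B1 : zmodClosed Z1)}).

End Cohomology.

Section Functoriality.
Variables (G : set GQ) (A B : gmodule) (f : ghom A B).

Lemma Z1_map_subproof (c : Z1 G A) : (fun s => f (c s)) \in @Z1_pred G B.
Proof.
have fD x y : f (x + y) = f x + f y.
  have f0 : f 0 = 0 by rewrite -(subrr (0 : A)) ghB subrr.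
  by rewrite -[y in LHS]opprK ghB -[- y]sub0r ghB f0 sub0r opprK.
have /asboolP [cM cC] := z1P c; apply/asboolP; split=> [s t Gs Gt|k s Gs].
  by rewrite cM // fD gh_act.
have [l fl] := gh_cont f k; have [X cX] := cC l s Gs.
by exists X => t Gt st; rewrite -ghB; apply/fl/cX.
Qed.

Definition Z1_map (c : Z1 G A) : Z1 G B := MkZ1 (Z1_map_subproof c).

(* Independent of the representative, since f maps coboundaries to
   coboundaries. *)
Definition H1_map (x : H1 G A) : H1 G B := H1_class (Z1_map (H1_repr x)).

End Functoriality.

Section Iwasawa.
Variables (p : nat) (p_prime : prime p) (O : idomainType) (pi : O).
Variables (V : lmodType O) (act : GQ -> {linear V -> V}).
Variable kac : GQ -> oneZp p_prime.

(* V (x) O[U n]: the function f stands for the sum of the f u (x) [u]. *)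
Definition LV (n : nat) : lmodType O := {ffun U p_prime n -> V}.

Definition LV_nbhs (n k : nat) : set (LV n) :=
  [set f | forall u, adic pi k (f u)].

(* s (v (x) [u]) = s v (x) [kac(s)^-1 u] *)
Definition LV_act (n : nat) (s : GQ) (f : LV n) : LV n :=
  [ffun u => act s (f (kac s n * u)%g)].

Definition LV_shift (n : nat) (f : LV n) : LV n :=
  [ffun u => f ((u_gen p_prime n)^-1 * u)%g].

(* The action of O[X], with X acting as [1+p] - 1. *)
Definition LV_scale (n : nat) (P : {poly O}) (f : LV n) : LV n :=
  \sum_(i < size P) P`_i *: iter i (fun h => LV_shift h - h) f.

Definition LV_pr (n : nat) (f : LV n.+1) : LV n :=
  [ffun u => \sum_(v : U p_prime n.+1 | u_red v == u) f v].

(* [u] is sent to the sum of its preimages. *)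
Definition LV_tr (n : nat) (f : LV n) : LV n.+1 := [ffun v => f (u_red v)].

Lemma adic0 k : adic pi k (0 : V).
Proof. by exists 0; rewrite scaler0. Qed.

Lemma adicB k (x y : V) : adic pi k x -> adic pi k y -> adic pi k (x - y).
Proof. by move=> [x' ->] [y' ->]; exists (x' - y'); rewrite scalerBr. Qed.

Lemma adicZ k a (x : V) : adic pi k x -> adic pi k (a *: x).
Proof. by move=> [y ->]; exists (a *: y); rewrite !scalerA mulrC. Qed.

Lemma adicD k (x y : V) : adic pi k x -> adic pi k y -> adic pi k (x + y).
Proof. by move=> [x' ->] [y' ->]; exists (x' + y'); rewrite scalerDr. Qed.

Lemma LV_nbhs0 n k : LV_nbhs k (0 : LV n).
Proof. by move=> u; rewrite ffunE; apply: adic0. Qed.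

Lemma LV_nbhsB n k (f g : LV n) :
  LV_nbhs k f -> LV_nbhs k g -> LV_nbhs k (f - g).
Proof. by move=> fk gk u; rewrite !ffunE; apply: adicB. Qed.

Lemma LV_actB n s (f g : LV n) : LV_act s (f - g) = LV_act s f - LV_act s g.
Proof. by apply/ffunP=> u; rewrite !ffunE raddfB. Qed.

Definition LV_mod (n : nat) : gmodule :=
  @GModule (LV n) (@LV_nbhs n) (@LV_act n) (@LV_nbhs0 n) (@LV_nbhsB n)
    (@LV_actB n).

Lemma LV_shiftB n (f g : LV n) : LV_shift (f - g) = LV_shift f - LV_shift g.
Proof. by apply/ffunP=> u; rewrite !ffunE. Qed.

Lemma LV_scaleB n P (f g : LV n) :
  LV_scale P (f - g) = LV_scale P f - LV_scale P g.
Proof.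
rewrite /LV_scale -sumrB; apply: eq_bigr => i _; rewrite -scalerBr.
congr (_ *: _); elim: (i : nat) => //= j ->.
by rewrite LV_shiftB !opprD !opprK addrACA.
Qed.

Lemma LV_shift_act n s (f : LV n) : LV_shift (LV_act s f) = LV_act s (LV_shift f).
Proof.
apply/ffunP=> u; rewrite !ffunE; congr (act s (f _)).
by rewrite !mulgA; congr (_ * _)%g; apply: u_mulC.
Qed.

Lemma LV_scale_act n P s (f : LV n) :
  LV_scale P (LV_act s f) = LV_act s (LV_scale P f).
Proof.
have actZ a (h : LV n) : LV_act s (a *: h) = a *: LV_act s h.
  by apply/ffunP=> u; rewrite !ffunE linearZ.
have actS (I : finType) (h : I -> LV n) :
  LV_act s (\sum_i h i) = \sum_i LV_act s (h i).
  apply/ffunP=> u; rewrite ffunE !sum_ffunE raddf_sum.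
  by apply: eq_bigr => i _; rewrite ffunE.
rewrite /LV_scale actS; apply: eq_bigr => i _; rewrite actZ; congr (_ *: _).
by elim: (i : nat) => //= j ->; rewrite LV_shift_act LV_actB.
Qed.

Lemma LV_scale_cont n P k : exists l, forall f : LV n,
  LV_nbhs l f -> LV_nbhs k (LV_scale P f).
Proof.
exists k => f fk u; rewrite sum_ffunE.
elim/big_ind: _ => [|x y|i _]; [exact: adic0|exact: adicD|].
rewrite ffunE; apply: adicZ.
elim: (i : nat) u => [|j IH] u //=; rewrite !ffunE.
by apply: adicB; apply: IH.
Qed.

Definition LV_scale_hom (n : nat) (P : {poly O}) :
    ghom (LV_mod n) (LV_mod n) :=
  @GHom (LV_mod n) (LV_mod n) (@LV_scale n P) (@LV_scaleB n P)
    (@LV_scale_act n P) (@LV_scale_cont n P).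

Lemma LV_prB n (f g : LV n.+1) : LV_pr (f - g) = LV_pr f - LV_pr g.
Proof.
apply/ffunP=> u; rewrite !ffunE -sumrB.
by apply: eq_bigr => v _; rewrite !ffunE.
Qed.

Lemma LV_pr_act n s (f : LV n.+1) : LV_pr (LV_act s f) = LV_act s (LV_pr f).
Proof.
apply/ffunP=> u; rewrite !ffunE raddf_sum.
rewrite [RHS](reindex_inj (mulgI (kac s n.+1))) /=.
apply: eq_big => [v|v _]; last by rewrite ffunE.
by rewrite u_redM oz_compat (can_eq (mulKg _)).
Qed.

Lemma LV_pr_cont n k : exists l, forall f : LV n.+1,
  LV_nbhs l f -> LV_nbhs k (LV_pr f).
Proof.
exists k => f fk u; rewrite ffunE.
by elim/big_ind: _ => [|x y|i _]; [exact: adic0|exact: adicD|exact: fk].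
Qed.

Definition LV_pr_hom (n : nat) : ghom (LV_mod n.+1) (LV_mod n) :=
  @GHom (LV_mod n.+1) (LV_mod n) (@LV_pr n) (@LV_prB n) (@LV_pr_act n)
    (@LV_pr_cont n).

Lemma LV_trB n (f g : LV n) : LV_tr (f - g) = LV_tr f - LV_tr g.
Proof. by apply/ffunP=> u; rewrite !ffunE. Qed.

Lemma LV_tr_act n s (f : LV n) : LV_tr (LV_act s f) = LV_act s (LV_tr f).
Proof. by apply/ffunP=> u; rewrite !ffunE u_redM oz_compat. Qed.

Lemma LV_tr_cont n k : exists l, forall f : LV n,
  LV_nbhs l f -> LV_nbhs k (LV_tr f).
Proof. by exists k => f fk u; rewrite ffunE; apply: fk. Qed.

Definition LV_tr_hom (n : nat) : ghom (LV_mod n) (LV_mod n.+1) :=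
  @GHom (LV_mod n) (LV_mod n.+1) (@LV_tr n) (@LV_trB n) (@LV_tr_act n)
    (@LV_tr_cont n).

(* Since Lambda = O[[1+pZ_p]] is the inverse limit of the O[U n], V (x) Lambda
   is that of the V (x) O[U n] when V is free of finite rank. *)
Record LVoo := MkLVoo {
  lv_comp :> forall n, LV n;
  lv_compat : forall n, LV_pr (lv_comp n.+1) = lv_comp n
}.

Lemma LVoo_eq (x y : LVoo) : (forall n, x n = y n) -> x = y.
Proof.
case: x => x xP; case: y => y yP /= xy.
have {}xy : x = y by apply: functional_extensionality_dep.
by move: yP; rewrite -xy => yP; rewrite (Prop_irrelevance xP yP).
Qed.

HB.instance Definition _ := gen_eqMixin LVoo.
HB.instance Definition _ := gen_choiceMixin LVoo.

Lemma LV_pr0 n : LV_pr (0 : LV n.+1) = 0.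
Proof. by rewrite -(subrr (0 : LV n.+1)) LV_prB !subrr. Qed.

Lemma LV_prN n (f : LV n.+1) : LV_pr (- f) = - LV_pr f.
Proof. by rewrite -[- f]sub0r LV_prB LV_pr0 sub0r. Qed.

Lemma LV_prD n (f g : LV n.+1) : LV_pr (f + g) = LV_pr f + LV_pr g.
Proof. by rewrite -[g in LHS]opprK LV_prB LV_prN opprK. Qed.

Definition LVoo_zero : LVoo := @MkLVoo (fun n => 0) LV_pr0.
Definition LVoo_opp (x : LVoo) : LVoo :=
  @MkLVoo (fun n => - x n)
    (fun n => etrans (LV_prN _) (congr1 -%R (lv_compat x n))).
Definition LVoo_add (x y : LVoo) : LVoo :=
  @MkLVoo (fun n => x n + y n)
    (fun n => etrans (LV_prD _ _)
      (congr2 +%R (lv_compat x n) (lv_compat y n))).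

Lemma LVoo_addA : associative LVoo_add.
Proof. by move=> x y z; apply: LVoo_eq => n; apply: addrA. Qed.
Lemma LVoo_addC : commutative LVoo_add.
Proof. by move=> x y; apply: LVoo_eq => n; apply: addrC. Qed.
Lemma LVoo_add0 : left_id LVoo_zero LVoo_add.
Proof. by move=> x; apply: LVoo_eq => n; apply: add0r. Qed.
Lemma LVoo_addN : left_inverse LVoo_zero LVoo_opp LVoo_add.
Proof. by move=> x; apply: LVoo_eq => n; apply: addNr. Qed.

HB.instance Definition _ :=
  GRing.isZmodule.Build LVoo LVoo_addA LVoo_addC LVoo_add0 LVoo_addN.

(* A neighbourhood base of 0 for the inverse limit topology. *)
Definition LVoo_nbhs (k : nat) : set LVoo :=
  [set x | forall i, (i <= k)%N -> LV_nbhs k (x i)].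

Definition LVoo_act (s : GQ) (x : LVoo) : LVoo :=
  @MkLVoo (fun n => LV_act s (x n))
    (fun n => etrans (LV_pr_act s _) (congr1 (@LV_act n s) (lv_compat x n))).

Lemma LVoo_nbhs0 k : LVoo_nbhs k 0.
Proof. by move=> i _; apply: LV_nbhs0. Qed.

Lemma LVoo_nbhsB k (x y : LVoo) :
  LVoo_nbhs k x -> LVoo_nbhs k y -> LVoo_nbhs k (x - y).
Proof.
by move=> xk yk i ik; apply: (LV_nbhsB (f := x i) (g := y i)); auto.
Qed.

Lemma LVoo_actB s (x y : LVoo) :
  LVoo_act s (x - y) = LVoo_act s x - LVoo_act s y.
Proof. by apply: LVoo_eq => n; apply: (LV_actB s (x n) (y n)). Qed.

Definition LVoo_mod : gmodule :=
  @GModule LVoo LVoo_nbhs LVoo_act LVoo_nbhs0 LVoo_nbhsB LVoo_actB.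

Lemma LVoo_pr_cont n k : exists l, forall x : LVoo,
  LVoo_nbhs l x -> LV_nbhs k (x n).
Proof.
exists (n + k)%N => x xl u; have [y ->] := xl n (leq_addr _ _) u.
by exists (pi ^+ n *: y); rewrite scalerA -exprD addnC.
Qed.

Definition LVoo_pr_hom (n : nat) : ghom LVoo_mod (LV_mod n) :=
  @GHom LVoo_mod (LV_mod n) (fun x : LVoo => x n) (fun x y => erefl)
    (fun s x => erefl) (@LVoo_pr_cont n).

Variable G : set GQ.

Definition H1n (n : nat) : zmodType := H1 G (LV_mod n).
Definition H1oo : zmodType := H1 G LVoo_mod.

Definition pr (n : nat) : H1n n.+1 -> H1n n := H1_map (LV_pr_hom n).
Definition Tr (n : nat) : H1n n -> H1n n.+1 := H1_map (LV_tr_hom n).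
Definition pr_oo (n : nat) : H1oo -> H1n n := H1_map (LVoo_pr_hom n).
Definition scale (n : nat) (P : {poly O}) : H1n n -> H1n n :=
  H1_map (LV_scale_hom n P).

(* Matrices over O[X], a subring of Lambda = O[[X]], acting on pairs. *)
Definition mat_act (n : nat) (C : 'M[{poly O}]_2) (v : H1n n * H1n n) :
    H1n n * H1n n :=
  (scale (C ord0 ord0) v.1 + scale (C ord0 ord_max) v.2,
   scale (C ord_max ord0) v.1 + scale (C ord_max ord_max) v.2).

End Iwasawa.

Section LogarithmicMatrix.
Variables (p : nat) (O : idomainType) (ap chip : O).

Definition Phi (n : nat) : {poly O} :=
  \sum_(j < p) (1 + 'X) ^+ (j * p ^ n.-1).

Definition Cg (n : nat) : 'M[{poly O}]_2 :=
  \matrix_(i, j)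
    if i == ord0 then (if j == ord0 then ap%:P else 1)
    else (if j == ord0 then - chip%:P * Phi n else 0).

(* C_{g,n} ... C_{g,1} *)
Fixpoint Cg_prod (n : nat) : 'M[{poly O}]_2 :=
  if n is k.+1 then Cg k.+1 *m Cg_prod k else 1%:M.

End LogarithmicMatrix.

(* Main.v *)
(** Put T = 1 + X, omega_n = T^(p^(n-1)) - 1, so that Lambda_n = O[T]/(omega_n)
    and omega_{n+1} = Phi_n omega_n. Row by row, C_{g,n} ... C_{g,1} (x, y) is
    (z_n, - chi Phi_n z_{n-1}), where z_0 = x, z_1 = a x + y and
    z_{n+2} = a z_{n+1} - chi Phi_{n+1} z_n. At the level of modules,
    (x, y) |-> (z_n mod omega_{n+1})_n identifies (V (x) Lambda)^2 with the
    sequences s_{n+1} in V (x) Lambda_{n+1} such that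
    pr s_{n+3} = a s_{n+2} - chi Tr s_{n+1}. Truncated sequences are lifted by
    running the recursion downwards. If all z_n are small for n <= N, write
    z_n = f_n omega_{n+1}; then chi f_n = a f_{n+1} - Phi_{n+2} f_{n+2}, where a
    lies in the maximal ideal (g is nonordinary at p) and Phi_j = p modulo
    omega_i for j >= i, so f_0 and f_1 are small. This estimate gives
    injectivity, convergence of the lifts, and continuity of the inverse.

    For classes, representing cocycles can be adjusted by coboundaries so that
    the recursion holds exactly, because the projections are surjective on
    coefficients; solving it pointwise gives existence. For uniqueness, if all
    z_n are coboundaries of elements b_n, then the b_n satisfy the recursion
    because H^0(K[m], V (x) Lambda_n) = 0. The latter reduces to
    H^0(K, V / pi V) = 0, as a p-group acting on a nonzero finite p-group has
    nonzero invariants. *)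

Require Import Defs.
From HB Require Import structures.
From mathcomp Require Import all_boot all_order all_fingroup all_algebra all_field.
From mathcomp Require Import all_solvable.
From mathcomp Require Import complex.
From mathcomp Require Import all_classical all_reals all_analysis.
From mathcomp Require Import ring zify.

Set Implicit Arguments.
Unset Strict Implicit.
Unset Printing Implicit Defensive.

Import Order.TTheory GRing.Theory Num.Theory.
Local Open Scope classical_set_scope.
Local Open Scope ring_scope.

(** * The groups (1 + pZ_p) / (1 + p^n Z_p) *)

Section OneUnitGroups.
Variables (p : nat) (p_prime : prime p) (p_odd : odd p).

(** Binomial expansion of [(1 + y) ^ p] with [p ^ k.+1] dividing [y]: the linear term is [p * y],
    the terms [2 <= i < p] gain a factor [p] from ['C(p, i)], and [y ^ p] is small enough because
    [p >= 3]. *)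
Lemma one_plus_p_expn k :
  exists d, (p.+1 ^ (p ^ k) = 1 + p ^ k.+1 * (1 + p * d))%N.
Proof.
have p_gt2 : (2 < p)%N by apply: odd_prime_gt2.
elim: k => [|k [d IH]]; first by exists 0; rewrite expn0 !expn1; lia.
rewrite expnSr expnM IH; set y := (p ^ k.+1 * _)%N.
have yd i : (p ^ (k.+1 * i) %| y ^ i)%N.
  by rewrite /y expnMn -expnM dvdn_mulr.
rewrite expnDn -(big_mkord xpredT
  (fun i => 'C(p, i) * (1 ^ (p - i) * y ^ i))%N) big_ltn // big_ltn; last by lia.
rewrite !exp1n !mul1n bin0 expn0 bin1 expn1 muln1.
have /dvdnP [q ->] : (p ^ k.+3 %|
    \sum_(2 <= i < p.+1) 'C(p, i) * (1 ^ (p - i) * y ^ i))%N.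
  rewrite big_nat; apply: dvdn_sum => i /andP [i2 ip]; rewrite exp1n mul1n.
  have [->|i_neq_p] := eqVneq i p.
    apply: dvdn_mull; apply: dvdn_trans (yd p); rewrite dvdn_exp2l //.
    by apply: (@leq_trans (k.+1 * 3)); [lia | rewrite leq_mul2l; lia].
  rewrite (expnS p k.+2) dvdn_mul //; first by apply: prime_dvd_bin => //; lia.
  apply: dvdn_trans (yd _); rewrite dvdn_exp2l //.
  by apply: (@leq_trans (k.+1 * 2)); [lia | rewrite leq_mul2l; lia].
exists (d + q)%N; rewrite /y !expnS; lia.
Qed.

(** Successive approximation: [(1 + p) ^ (p ^ n)] is [1 + p ^ n.+1] modulo [p ^ n.+2], so a power of
    it corrects the next digit. *)
Lemma one_plus_p_generates n u : (u == 1 %[mod p])%N ->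
  exists i, (p.+1 ^ i == u %[mod p ^ n.+1])%N.
Proof.
move=> u1; elim: n => [|n [i IH]]; first by exists 0; rewrite expn0 expn1 eq_sym.
have [d E] := one_plus_p_expn n.
set A := (p.+1 ^ i)%N in IH.
(* The added multiple of the modulus keeps the subtraction in nat from truncating. *)
have le : (A <= u + p ^ n.+2 * A)%N.
  by rewrite (leq_trans _ (leq_addl _ _)) // leq_pmull // expn_gt0 prime_gt0.
have /dvdnP [j Ej] : (p ^ n.+1 %| u + p ^ n.+2 * A - A)%N.
  rewrite -eqn_mod_dvd // (eqP IH) expnS mulnAC addnC modnMDl //.
have E2 : (p.+1 ^ (p ^ n * j) == 1 + j * p ^ n.+1 %[mod p ^ n.+2])%N.
  rewrite expnM E; elim: j {Ej} => [|j IHj]; first by rewrite expn0 mul0n.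
  rewrite expnSr -modnMml (eqP IHj) modnMml; apply/eqP.
  have -> : ((1 + j * p ^ n.+1) * (1 + p ^ n.+1 * (1 + p * d)) =
     (d + j * p ^ n * (1 + p * d)) * p ^ n.+2 + (1 + j.+1 * p ^ n.+1))%N.
    by rewrite !expnS; lia.
  by rewrite modnMDl.
have Aone : (A == 1 %[mod p])%N by rewrite /A -modnXm -addn1 modnDl modnXm exp1n.
exists (i + p ^ n * j)%N; rewrite expnD -/A -modnMm (eqP E2) modnMm.
have [b Eb] : exists b, A = (1 + p * b)%N.
  exists (A %/ p)%N; rewrite {1}(divn_eq A p) (eqP Aone) modn_small ?prime_gt1 //.
  by rewrite mulnC addnC.
apply/eqP; have -> : (A * (1 + j * p ^ n.+1) = b * j * p ^ n.+2 + (A + j * p ^ n.+1))%N.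
  by rewrite {1}Eb mulnDr muln1 {1}Eb !expnS; lia.
by rewrite modnMDl -Ej subnKC // addnC mulnC modnMDl.
Qed.

Local Notation U := (U p_prime).
Local Notation gen n := (u_gen p_prime n).

Lemma u_val_gen n : u_val (gen n) = (p.+1 %% p ^ n.-1.+1)%N.
Proof. by rewrite u_of_natK // -addn1 modnDl. Qed.

Lemma u_val1 n : u_val (1%g : U n) = 1%N.
Proof. by rewrite /u_val /= Zp_cast ?(level_gt1 p_prime) // modn_small // (level_gt1 p_prime). Qed.

Lemma u_val_expg n (u : U n) i :
  u_val (u ^+ i)%g = (u_val u ^ i %% p ^ n.-1.+1)%N.
Proof.
elim: i => [|i IH]; first by rewrite expg0 u_val1 expn0 modn_small ?(level_gt1 p_prime).
by rewrite expgS u_val_mul // IH modnMmr -expnS.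
Qed.

Lemma u_val_gen_expg n i : u_val (gen n ^+ i)%g = (p.+1 ^ i %% p ^ n.-1.+1)%N.
Proof. by rewrite u_val_expg u_val_gen modnXm. Qed.

Lemma u_gen_generates n (u : U n) : u \in <[gen n]>%g.
Proof.
have [i /eqP Ei] := one_plus_p_generates n.-1 (u_valP u).
apply/cycleP; exists i; apply: u_val_inj => //.
by rewrite u_val_gen_expg Ei modn_small ?u_val_lt.
Qed.

Lemma order_u_gen n : #[gen n]%g = (p ^ n.-1)%N.
Proof.
have dvd k : (p ^ k %| p ^ k.+2)%N by rewrite dvdn_exp2l // -addn2 leq_addr.
have ord : (#[gen n]%g %| p ^ n.-1)%N.
  rewrite order_dvdn; apply/eqP/u_val_inj => //; rewrite u_val_gen_expg u_val1.
  have [d ->] := one_plus_p_expn n.-1.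
  by rewrite addnC mulnC modnMDl modn_small ?(level_gt1 p_prime).
have /(dvdn_pfactor _ _ p_prime) [k kn ok] := ord.
rewrite ok; congr (p ^ _)%N; apply/eqP; rewrite eqn_leq kn /= leqNgt.
apply/negP => lt_kn; have {}ok : (gen n ^+ (p ^ k) = 1)%g by rewrite -ok expg_order.
have := congr1 (@u_val p p_prime n) ok; rewrite u_val_gen_expg u_val1.
have [d ->] := one_plus_p_expn k; move=> E.
have : (1 + p ^ k.+1 * (1 + p * d) == 1 %[mod p ^ n.-1.+1])%N.
  by rewrite E modn_small ?(level_gt1 p_prime).
rewrite eqn_mod_dvd ?leq_addr // addKn => /(dvdn_trans (dvdn_exp2l p (_ : k.+2 <= _)%N)).
move=> /(_ lt_kn); rewrite expnSr dvdn_pmul2l ?expn_gt0 ?prime_gt0 //.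
rewrite dvdn_addl ?dvdn_mulr // dvdn1 => /eqP p1.
by move: (prime_gt1 p_prime); rewrite p1.
Qed.

Lemma u_expgX n (u : U n) : (u ^+ (p ^ n.-1) = 1)%g.
Proof.
have /cycleP [i ->] := u_gen_generates u.
by rewrite -order_u_gen expgAC expg_order expg1n.
Qed.

Lemma u_gen_expg_eq n i j :
  (gen n ^+ i = gen n ^+ j)%g <-> i = j %[mod p ^ n.-1].
Proof.
rewrite -(order_u_gen n).
by split=> /eqP; [rewrite eq_expg_mod_order|rewrite -eq_expg_mod_order] => /eqP.
Qed.

Lemma u_gen_expgP n (u : U n) :
  exists2 i, (i < p ^ n.-1)%N & u = (gen n ^+ i)%g.
Proof.
case: (cyclePmin (u_gen_generates u)) => i.
by rewrite order_u_gen => *; exists i.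
Qed.

Lemma u_red_gen n : u_red (gen n.+1) = gen n.
Proof.
apply: u_val_inj => //; rewrite u_red_val // !u_val_gen modn_dvdm //.
by rewrite dvdn_exp2l //; case: n.
Qed.

Lemma u_red_expg n (u : U n.+1) i : u_red (u ^+ i)%g = (u_red u ^+ i)%g.
Proof.
elim: i => [|i IH]; last by rewrite !expgS u_redM // IH.
by rewrite !expg0; apply/(mulgI (u_red 1%g)); rewrite -u_redM // !mulg1.
Qed.

Lemma u_red_gen_expg n i : u_red (gen n.+1 ^+ i)%g = (gen n ^+ i)%g.
Proof. by rewrite u_red_expg u_red_gen. Qed.

(** The kernel of reduction is generated by [gen n.+2 ^+ (p ^ n)], of order [p]. The levels start at
    [n.+2] because [U 1] and [U 0] are both trivial. *)
Lemma u_red_fibreP n (u v : U n.+2) : u_red u = u_red v ->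
  exists! j : 'I_p, u = (gen n.+2 ^+ (j * p ^ n) * v)%g.
Proof.
have /cycleP [i ->] := u_gen_generates u; have /cycleP [k ->] := u_gen_generates v.
rewrite !u_red_gen_expg => /u_gen_expg_eq /= ik.
have p_gt0 := prime_gt0 p_prime; have pn_gt0 : (0 < p ^ n)%N by rewrite expn_gt0 p_gt0.
have le : (k <= i + k * p ^ n.+1)%N.
  by rewrite (leq_trans _ (leq_addl _ _)) // leq_pmulr // expn_gt0 p_gt0.
have /dvdnP [j Ej] : (p ^ n %| i + k * p ^ n.+1 - k)%N.
  by rewrite -eqn_mod_dvd // expnS mulnA addnC modnMDl ik.
have jp : (j %% p < p)%N by rewrite ltn_mod.
exists (Ordinal jp); split=> [|l El].
  suff: (gen n.+2 ^+ i = gen n.+2 ^+ (j %% p * p ^ n + k))%g by rewrite expgD.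
  apply/u_gen_expg_eq => /=.
  have -> : (i = i + k * p ^ n.+1 %[mod p ^ n.+1])%N by rewrite addnC modnMDl.
  rewrite -[in LHS](subnK le) Ej {1}(divn_eq j p) mulnDl -addnA -mulnA -expnS.
  by rewrite modnMDl.
have /u_gen_expg_eq /= E : (gen n.+2 ^+ i = gen n.+2 ^+ (l * p ^ n + k))%g.
  by rewrite expgD.
apply: val_inj => /=; have /eqP : (j * p ^ n + k = l * p ^ n + k %[mod p ^ n.+1])%N.
  by rewrite -Ej subnK // -E addnC modnMDl.
rewrite eqn_modDr expnS -!muln_modl // eqn_pmul2r // => /eqP ->.
by rewrite modn_small.
Qed.

End OneUnitGroups.

(** * The polynomial action on V[U n] *)

Section PolynomialAction.
Variables (O : idomainType) (V : lmodType O) (D : V -> V).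
Hypothesis D_linear : linear D.

(** [D] is arbitrary because two cases occur: the shift minus 1, by which X acts in [LV_scale], and
    the shift itself, by which T = 1 + X acts. *)
Definition poly_act (P : {poly O}) (f : V) : V :=
  \sum_(i < size P) P`_i *: iter i D f.

Lemma iter_linear i : linear (iter i D).
Proof. by move=> a f g; elim: i => //= i ->; rewrite D_linear. Qed.

Implicit Types (P Q : {poly O}) (f : V).

Lemma poly_act_widen P m f : (size P <= m)%N ->
  poly_act P f = \sum_(i < m) P`_i *: iter i D f.
Proof.
move=> Pm; rewrite /poly_act (big_ord_widen _ (fun i => P`_i *: iter i D f) Pm).
rewrite big_mkcond; apply: eq_bigr => i _; case: ltnP => // leP.
by rewrite nth_default // scale0r.
Qed.

Lemma poly_act_is_linear P : linear (poly_act P).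
Proof.
move=> a f g; rewrite /poly_act scaler_sumr -big_split; apply: eq_bigr => i _ /=.
by rewrite iter_linear scalerDr !scalerA mulrC.
Qed.

Lemma poly_actD P Q f : poly_act (P + Q) f = poly_act P f + poly_act Q f.
Proof.
have PQ := size_polyD P Q; rewrite !(@poly_act_widen _ (maxn (size P) (size Q))) //.
- by rewrite -big_split; apply: eq_bigr => i _ /=; rewrite coefD scalerDl.
- exact: leq_maxr.
- exact: leq_maxl.
Qed.

Lemma poly_actC c f : poly_act c%:P f = c *: f.
Proof.
by rewrite (@poly_act_widen _ 1) ?size_polyC_leq1 // big_ord1 coefC eqxx.
Qed.

Lemma poly_act1 f : poly_act 1 f = f.
Proof. by rewrite poly_actC scale1r. Qed.

Lemma poly_act0 f : poly_act 0 f = 0.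
Proof. by rewrite poly_actC scale0r. Qed.

Lemma poly_actMX P f : poly_act (P * 'X) f = poly_act P (D f).
Proof.
rewrite (@poly_act_widen _ (size P).+1); last first.
  have [->|P0] := eqVneq P 0; first by rewrite mul0r size_poly0.
  by rewrite size_mulX.
rewrite big_ord_recl coefMX scale0r add0r; apply: eq_bigr => i _.
by rewrite coefMX lift0 -iterSr.
Qed.

Lemma poly_actM P Q f : poly_act (P * Q) f = poly_act P (poly_act Q f).
Proof.
elim/poly_ind: P f => [|P c IH] f; first by rewrite mul0r !poly_act0.
rewrite mulrDl !poly_actD -mulrA (mulrC 'X) mulrA !poly_actMX IH.
rewrite (_ : poly_act Q (D f) = D (poly_act Q f)); last first.
  have D0 : D 0 = 0 by have := D_linear (-1) 0 0; rewrite scaler0 add0r scaleN1r addNr.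
  have DD : {morph D : x y / x + y}.
    by move=> x y; rewrite -[x in LHS]scale1r D_linear scale1r.
  rewrite /poly_act (big_morph D DD D0); apply: eq_bigr => i _.
  have DZ a x : D (a *: x) = a *: D x by rewrite -[a *: x]addr0 D_linear D0 addr0.
  by rewrite DZ -iterSr.
congr (_ + _); rewrite poly_actC mul_polyC /poly_act.
rewrite scaler_sumr [LHS](@poly_act_widen _ (size Q)) ?size_scale_leq //.
by apply: eq_bigr => i _; rewrite coefZ scalerA.
Qed.

Lemma poly_actXn m f : poly_act 'X^m f = iter m D f.
Proof.
elim: m f => [|m IH] f; first by rewrite expr0 poly_act1.
by rewrite exprSr poly_actMX IH -iterSr.
Qed.

Lemma poly_actN P f : poly_act (- P) f = - poly_act P f.
Proof. by apply/eqP; rewrite -addr_eq0 -poly_actD addNr poly_act0. Qed.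

Lemma poly_act_sum I (r : seq I) (P : I -> {poly O}) f :
  poly_act (\sum_(i <- r) P i) f = \sum_(i <- r) poly_act (P i) f.
Proof.
by apply: (big_morph (poly_act^~ f)); [move=> P1 P2; apply: poly_actD|apply: poly_act0].
Qed.

End PolynomialAction.

Lemma poly_act_morph (O : idomainType) (V W : lmodType O) (D : V -> V)
    (E : W -> W) (h : V -> W) (P : {poly O}) f :
  linear h -> (forall x, h (D x) = E (h x)) ->
  h (poly_act D P f) = poly_act E P (h f).
Proof.
move=> h_linear hD.
have h0 : h 0 = 0 by have := h_linear (-1) 0 0; rewrite scaler0 add0r scaleN1r addNr.
have hDD : {morph h : x y / x + y}.
  by move=> x y; rewrite -[x in LHS]scale1r h_linear scale1r.
rewrite /poly_act (big_morph h hDD h0); apply: eq_bigr => i _.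
rewrite -[_ *: iter i D f]addr0 h_linear h0 addr0; congr (_ *: _).
by elim: (i : nat) => //= j IH; rewrite hD IH.
Qed.

(** * The operators X, pr and Tr on V[U n] *)

Section Levels.
Variables (p : nat) (p_prime : prime p) (O : idomainType) (V : lmodType O).
Local Notation LV := (LV p_prime V).
Local Notation gen n := (u_gen p_prime n).

Lemma LV_shift_is_linear n : linear (@LV_shift p p_prime O V n).
Proof. by move=> a f g; apply/ffunP=> u; rewrite !ffunE. Qed.

Lemma LV_diff_is_linear n : linear (fun f : LV n => LV_shift f - f).
Proof.
by move=> a f g /=; rewrite LV_shift_is_linear scalerBr opprD addrACA.
Qed.

Lemma LV_scaleE n P (f : LV n) :
  LV_scale P f = poly_act (fun h : LV n => LV_shift h - h) P f.
Proof. by []. Qed.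

Lemma LV_scale_linear n P : linear (fun f : LV n => LV_scale P f).
Proof. exact: poly_act_is_linear (@LV_diff_is_linear n) P. Qed.

Lemma LV_scaleD n P Q (f : LV n) :
  LV_scale (P + Q) f = LV_scale P f + LV_scale Q f.
Proof. exact: poly_actD. Qed.

Lemma LV_scaleM n P Q (f : LV n) : LV_scale (P * Q) f = LV_scale P (LV_scale Q f).
Proof. exact: poly_actM (@LV_diff_is_linear n) P Q f. Qed.

Lemma LV_scaleC n c (f : LV n) : LV_scale c%:P f = c *: f.
Proof. exact: poly_actC. Qed.

Lemma LV_scaleN n P (f : LV n) : LV_scale (- P) f = - LV_scale P f.
Proof. exact: poly_actN. Qed.

Lemma iter_LV_shift n m (f : LV n) u :
  iter m (@LV_shift p p_prime O V n) f u = f ((gen n ^+ m)^-1 * u)%g.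
Proof.
elim: m u => [|m IH] u; first by rewrite expg0 invg1 mul1g.
by rewrite iterS ffunE IH mulgA -invMg -expgS.
Qed.

Lemma LV_scale_1X n m (f : LV n) :
  LV_scale ((1 + 'X) ^+ m) f = iter m (@LV_shift p p_prime O V n) f.
Proof.
elim: m => [|m IH]; first by rewrite expr0 LV_scaleC scale1r.
rewrite exprS LV_scaleM IH LV_scaleD LV_scaleC scale1r.
rewrite -[X in LV_scale X]expr1 LV_scaleE poly_actXn /=.
by rewrite addrC subrK.
Qed.

Lemma LV_scale_Phi n k (f : LV n) :
  LV_scale (Phi p O k) f =
    \sum_(j < p) iter (j * p ^ k.-1) (@LV_shift p p_prime O V n) f.
Proof.
rewrite LV_scaleE poly_act_sum; apply: eq_bigr => j _.
exact: LV_scale_1X.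
Qed.

Lemma LV_pr_linear n : linear (fun f : LV n.+1 => LV_pr f).
Proof.
move=> a f g; apply/ffunP=> u; rewrite !ffunE scaler_sumr -big_split.
by apply: eq_bigr => v _; rewrite !ffunE.
Qed.

Hypothesis p_odd : odd p.

Lemma LV_pr_shift n (f : LV n.+1) : LV_pr (LV_shift f) = LV_shift (LV_pr f).
Proof.
apply/ffunP=> u; rewrite !ffunE.
rewrite [LHS](reindex_inj (mulgI (gen n.+1))) /=.
apply: eq_big => [v|v _]; last by rewrite ffunE mulKg.
by rewrite u_redM u_red_gen // (canF_eq (mulKg _)) eq_sym.
Qed.

Lemma LV_pr_scale n P (f : LV n.+1) : LV_pr (LV_scale P f) = LV_scale P (LV_pr f).
Proof.
rewrite !LV_scaleE; apply: (@poly_act_morph _ _ _ _ _ (@LV_pr p p_prime O V n)).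
  exact: LV_pr_linear.
by move=> x; rewrite LV_prB LV_pr_shift.
Qed.

(** The elements with the same reduction as [v] are its translates by powers of
    [gen n.+2 ^+ (p ^ n)]; summing over them is the action of the sum of the T^(j p^n). *)
Lemma LV_tr_pr n (f : LV n.+2) : LV_tr (LV_pr f) = LV_scale (Phi p O n.+1) f.
Proof.
apply/ffunP=> v; rewrite !ffunE LV_scale_Phi sum_ffunE.
(* [h] enumerates this fibre and [h'] inverts it; on the fibre the default value of [h'] is never
   reached. *)
pose h (j : 'I_p) := ((gen n.+2 ^+ (j * p ^ n))^-1 * v)%g.
have p_gt0 := prime_gt0 p_prime.
pose h' w := odflt (Ordinal p_gt0) [pick j : 'I_p | h j == w].
have red_h j : u_red (h j) = u_red v.
  rewrite u_redM; apply: (mulgI (u_red (gen n.+2 ^+ (j * p ^ n))%g)).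
  rewrite mulgA -u_redM mulgV; congr (_ * _)%g.
  rewrite u_red_gen_expg // -[(1 : U p_prime n.+2)%g](expg0 (gen n.+2)).
  by rewrite u_red_gen_expg //; apply/u_gen_expg_eq; rewrite //= modnMl mod0n.
have h_inj : injective h.
  move=> i j ij; have [l [_ uniq_l]] := u_red_fibreP p_odd (esym (red_h i)).
  by rewrite -(uniq_l i) ?mulKVg // -(uniq_l j) // ij mulKVg.
have h'K j : h' (h j) = j.
  by rewrite /h'; case: pickP => [i /eqP /h_inj //|/(_ j)]; rewrite eqxx.
rewrite (reindex_onto h h') => [|w /eqP wv].
  apply: eq_big => [j|j _]; first by rewrite red_h h'K !eqxx.
  by rewrite iter_LV_shift.
have [j [Ej _]] := u_red_fibreP p_odd (esym wv).
by have -> : w = h j; [rewrite /h Ej mulKg|rewrite h'K].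
Qed.

Lemma LV_pr_surj n (f : LV n) : exists g, LV_pr g = f.
Proof.
pose lift (u : U p_prime n) := u_of_nat p_prime n.+1 (u_val u).
have liftK u : u_red (lift u) = u.
  apply: u_val_inj => //; rewrite u_red_val // u_of_natK ?u_valP //.
  rewrite modn_dvdm; first by rewrite modn_small ?u_val_lt.
  by rewrite dvdn_exp2l //; case: (n).
exists [ffun v => if v == lift (u_red v) then f (u_red v) else 0].
apply/ffunP=> u; rewrite !ffunE (bigD1 (lift u)) /=; last by rewrite liftK.
rewrite ffunE liftK eqxx big1 ?addr0 // => v /andP [/eqP uv nv].
by rewrite ffunE uv (negPf nv).
Qed.

End Levels.

(** * The three-term recursion over O[T] *)

Section Recursion.
Variables (O : idomainType) (a chi : O) (V : lmodType O) (phi : nat -> V -> V).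

(** Two consecutive terms are carried so that the three-term recursion is structural; [phi n] stands
    for multiplication by Phi_{n+1}. *)
Fixpoint zpair (x y : V) (n : nat) : V * V :=
  if n is m.+1 then
    let uv := zpair x y m in (uv.2, a *: uv.2 - chi *: phi m uv.1)
  else (x, a *: x + y).

(* [zseq x y n] is the first component of C_{g,n} ... C_{g,1} (x, y), and the
   second one is [- chi Phi_n (zseq x y n.-1)]. *)
Definition zseq (x y : V) (n : nat) : V := (zpair x y n).1.

Lemma zseq0 x y : zseq x y 0 = x. Proof. by []. Qed.
Lemma zseq1 x y : zseq x y 1 = a *: x + y. Proof. by []. Qed.
Lemma zseqSS x y n :
  zseq x y n.+2 = a *: zseq x y n.+1 - chi *: phi n (zseq x y n).
Proof. by []. Qed.

Lemma zseq_unique (z : nat -> V) N :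
  (forall n, (n.+2 <= N)%N -> z n.+2 = a *: z n.+1 - chi *: phi n (z n)) ->
  forall n, (n <= N)%N -> (0 < N)%N -> zseq (z 0) (z 1 - a *: z 0) n = z n.
Proof.
move=> zP n nN N0; suff: (n <= N)%N -> zseq (z 0) (z 1 - a *: z 0) n = z n /\
    ((n.+1 <= N)%N -> zseq (z 0) (z 1 - a *: z 0) n.+1 = z n.+1) by case/(_ nN).
elim: n {nN} => [|n IH] nN; first by rewrite zseq0 zseq1 addrC subrK.
have [|E1 E2] := IH; first exact: ltnW.
by split=> [|lt]; rewrite ?zseqSS ?E1 ?E2 // zP.
Qed.

End Recursion.

Lemma zseq_morph (O : idomainType) (a chi : O) (V V' : lmodType O)
    (phi : nat -> V -> V) (phi' : nat -> V' -> V') (h : V -> V') (x y : V) :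
  linear h -> (forall n v, h (phi n v) = phi' n (h v)) ->
  forall n, h (zseq a chi phi x y n) = zseq a chi phi' (h x) (h y) n.
Proof.
move=> h_linear hphi.
have hDZ c u v : h (c *: u + v) = c *: h u + h v by exact: h_linear.
have hBZ c d u v : h (c *: u - d *: v) = c *: h u - d *: h v.
  have h0 : h 0 = 0 by have := h_linear (-1) 0 0; rewrite scaler0 add0r scaleN1r addNr.
  by rewrite -(scaleNr d v) hDZ -[in h (- d *: v)](addr0 (- d *: v)) hDZ h0 addr0 scaleNr.
suff E n : h (zseq a chi phi x y n) = zseq a chi phi' (h x) (h y) n /\
    h (zseq a chi phi x y n.+1) = zseq a chi phi' (h x) (h y) n.+1.
  by move=> n; case: (E n).
elim: n => [|n [E1 E2]]; first by rewrite !zseq0 !zseq1 hDZ.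
by split=> //; rewrite !zseqSS hBZ hphi E1 E2.
Qed.

Section Polynomials.
Variables (p : nat) (p_prime : prime p) (O : idomainType) (pi a chi : O).
Hypotheses (pi_neq0 : pi != 0) (chi_unit : chi \is a GRing.unit).
Hypotheses (a_pi : exists b, a = pi * b) (p_pi : exists b, p%:R = pi * b).

(* In terms of [T = 1 + X], [omega n] is the polynomial with
   Lambda_n = O[T] / (omega n), and [cyclo n] is Phi_n. *)
Definition omega (n : nat) : {poly O} := 'X^(p ^ n.-1) - 1.
Definition cyclo (n : nat) : {poly O} := \sum_(j < p) 'X^(j * p ^ n.-1).

Lemma omegaS n : omega n.+2 = cyclo n.+1 * omega n.+1.
Proof.
rewrite /omega /cyclo /= expnSr exprM subrX1 mulrC; congr (_ * _).
by apply: eq_bigr => j _; rewrite mulnC exprM.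
Qed.

Lemma omega_dvd i m : exists q, 'X^(m * p ^ i.-1) - 1 = q * omega i.
Proof.
exists (\sum_(j < m) 'X^(p ^ i.-1) ^+ j).
by rewrite mulnC exprM subrX1 mulrC.
Qed.

(** The exponents [j * p ^ n.-1] are multiples of [p ^ i.-1], so each of the [p] summands is 1
    modulo [omega i]. *)
Lemma cyclo_mod_omega i n : (i <= n)%N -> exists q, cyclo n = p%:R + q * omega i.
Proof.
move=> le_in.
have /choice [q qP] (j : 'I_p) : exists q, 'X^(j * p ^ n.-1) = 1 + q * omega i.
  rewrite -(subnK (_ : i.-1 <= n.-1)%N) ?expnD ?mulnA; last lia.
  have [q Eq] := omega_dvd i (j * p ^ (n.-1 - i.-1)).
  by exists q; rewrite -Eq addrC subrK.
exists (\sum_j q j); rewrite /cyclo (eq_bigr _ (fun j _ => qP j)) big_split /=.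
by rewrite sumr_const card_ord mulr_suml.
Qed.

Lemma omega_monic n : omega n \is monic.
Proof. by rewrite monicXnsubC // expn_gt0 prime_gt0. Qed.

Lemma size_omega n : size (omega n) = (p ^ n.-1).+1.
Proof. by rewrite size_XnsubC // expn_gt0 prime_gt0. Qed.

(** Divide [r] by the monic [omega n], with quotient [q] and remainder [s]: then
    [omega n * (g - c q) = c s] has degree below that of [omega n], which forces [g = c q]. *)
Lemma omega_cancel n (c : O) (g r : {poly O}) :
  c != 0 -> omega n * g = c%:P * r -> exists h, g = c%:P * h.
Proof.
move=> c0 E; have W_mon := omega_monic n.
set q := Pdiv.Ring.rdivp r (omega n); set s := Pdiv.Ring.rmodp r (omega n).
have Er : r = q * omega n + s by exact: Pdiv.RingMonic.rdivp_eq.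
exists q; apply/eqP; rewrite -subr_eq0; apply/negPn/negP => nz.
have E2 : omega n * (g - c%:P * q) = c%:P * s by rewrite mulrBr E Er; ring.
have : (size (c%:P * s)%R < size (omega n))%N.
  by rewrite mul_polyC size_scale // Pdiv.Ring.ltn_rmodpN0 ?monic_neq0.
rewrite -E2 size_monicM // ltnNge -subn1.
have : (0 < size (g - c%:P * q)%R)%N by rewrite size_poly_gt0.
by move=> ?; rewrite -addnBA // leq_addr.
Qed.

(** The ideal (omega_i, pi^k); membership means that the image of [P] in O[T]/(omega_i) is divisible
    by pi^k. *)
Definition near0 (k i : nat) (P : {poly O}) : Prop :=
  exists q r, P = q * omega i + (pi ^+ k)%:P * r.

Lemma near0D k i P Q : near0 k i P -> near0 k i Q -> near0 k i (P + Q).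
Proof.
by move=> [q [r ->]] [q' [r' ->]]; exists (q + q'), (r + r'); ring.
Qed.

Lemma near0M k i P Q : near0 k i P -> near0 k i (Q * P).
Proof. by move=> [q [r ->]]; exists (Q * q), (Q * r); ring. Qed.

Lemma near0_pi k l i P : (k <= l)%N -> near0 k i ((pi ^+ l)%:P * P).
Proof.
move=> kl; exists 0, ((pi ^+ (l - k))%:P * P).
by rewrite mul0r add0r mulrA -polyCM -exprD subnKC.
Qed.

Lemma near0_omega k i P : near0 k i (P * omega i).
Proof. by exists P, 0; ring. Qed.

Lemma near0S k i b P : near0 k i P -> near0 k.+1 i ((pi * b)%:P * P).
Proof.
move=> [q [r ->]]; exists ((pi * b)%:P * q), (b%:P * r).
by rewrite exprS !polyCM; ring.
Qed.

Definition zrec (j : nat) (z : nat -> {poly O}) : Prop :=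
  forall n, z n.+2 = a%:P * z n.+1 - chi%:P * cyclo (j + n).+1 * z n.

(* If [z n = f n * omega n.+1], cancelling [omega n.+2] in the recursion gives
   [chi * f n = a * f n.+1 - cyclo n.+2 * f n.+2]. As [a] and, modulo
   [omega i], also [cyclo n.+2] are divisible by [pi] for large [n], the [f n]
   are small. *)
Lemma zrec_near0 z N l k i : zrec 0 z ->
  (forall n, (n <= N)%N -> near0 l n.+1 (z n)) ->
  (k <= l)%N -> (i + 2 * k < N)%N -> near0 k i (z 0) /\ near0 k i (z 1).
Proof.
move=> zP z_small kl iN.
have /choice [f fP] n : exists f : {poly O}, (n <= N)%N ->
    exists r, z n = f * omega n.+1 + (pi ^+ l)%:P * r.
  case: (leqP n N) => [/z_small [f [r Ef]]|_]; last by exists 0.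
  by exists f => _; exists r.
have [chi' chiK] : exists c : O, c * chi = 1 by exists chi^-1; rewrite mulVr.
(* The recursion solved for [f n] modulo pi^l, after cancelling [omega n.+2]. *)
have key n : (n.+2 <= N)%N -> exists h,
    f n = chi'%:P * (a%:P * f n.+1 - cyclo n.+2 * f n.+2) + (pi ^+ l)%:P * h.
  move=> nN; have [r0 E0] := fP n (ltnW (ltnW nN)).
  have [r1 E1] := fP _ (ltnW nN); have [r2 E2] := fP _ nN.
  have := zP n; rewrite E0 E1 E2 add0n => E.
  have [||h Eh] := @omega_cancel n.+2 (pi ^+ l)
    (cyclo n.+2 * f n.+2 - a%:P * f n.+1 + chi%:P * f n)
    (a%:P * r1 - chi%:P * cyclo n.+1 * r0 - r2).
  - exact: expf_neq0.
  - move: E; rewrite (omegaS n.+1) (omegaS n) => E.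
    by apply/eqP; rewrite -subr_eq0; apply/eqP; move/eqP: E; rewrite -subr_eq0 => /eqP <-; ring.
  exists (chi'%:P * h).
  have chiK' : chi'%:P * chi%:P = 1 :> {poly O} by rewrite -polyCM chiK.
  rewrite -[f n in LHS]mul1r -chiK' -mulrA.
  have -> : chi%:P * f n = (pi ^+ l)%:P * h - cyclo n.+2 * f n.+2 + a%:P * f n.+1.
    by rewrite -Eh; ring.
  by ring.
have [b Eb] := a_pi; have [b' Eb'] := p_pi.
(* From index [i] on, each descent gains a factor pi and looks at most two indices ahead, whence
   [n + 2 * t <= N]. *)
have high t : forall n, (i <= n)%N -> (t <= l)%N -> (n + 2 * t <= N)%N -> near0 t i (f n).
  elim: t => [|t IH] n le_in tl nN; first by exists 0, (f n); rewrite expr0; ring.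
  have [|h ->] := key n; first lia.
  have [q Eq] := @cyclo_mod_omega i n.+2 ltac:(lia).
  apply: near0D; last exact: near0_pi.
  apply: near0M; rewrite Eq Eb -polyC_natr Eb' mulrDl opprD.
  apply: near0D; first by apply/near0S/IH; lia.
  rewrite -!mulNr; apply: near0D.
    by rewrite -polyCN -mulrN; apply/near0S/IH; lia.
  by rewrite mulrAC; apply: near0_omega.
(* From index [i] down to 0 the descent merely preserves the precision reached. *)
have low n : (n <= i)%N -> near0 k i (f (i - n)%N) /\ near0 k i (f (i - n).+1%N).
  elim: n => [|n IH] ni; first by rewrite subn0; split; apply: high; lia.
  have [f1 f2] := IH (ltnW ni); rewrite -subnSK // in f1 f2; split=> //.
  have [|h ->] := key (i - n.+1)%N; first lia.
  apply: near0D; last exact: near0_pi.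
  by apply: near0M; apply: near0D; [|rewrite -mulNr]; apply: near0M.
have [f0 f1] := low i (leqnn i); rewrite subnn in f0 f1.
have [r0 ->] := fP 0%N isT; have [r1 ->] := fP 1%N ltac:(lia).
by split; (apply: near0D; last exact: near0_pi); rewrite mulrC; apply: near0M.
Qed.

(* The offset [j] allows an induction that lifts the tail of [S] first: modulo
   [omega j.+2] the recursion makes [z 1 - a z 0] of the lifted tail a multiple of
   [cyclo j.+1], and the cofactor is the new first term. *)
Lemma zrec_lift N : forall j (S : nat -> {poly O}),
  (forall n, exists q, S n.+2 = a%:P * S n.+1 - chi%:P * cyclo (j + n).+1 * S n
                                + q * omega (j + n).+2) ->
  exists z, zrec j z /\
    forall n, (n <= N.+1)%N -> exists q, z n = S n + q * omega (j + n).+1.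
Proof.
elim: N => [|N IH] j S SP.
  exists (zseq a chi (fun n f => cyclo (j + n).+1 * f) (S 0) (S 1 - a *: S 0)).
  split=> [n|[|[|n]] // _]; first by rewrite zseqSS -!mul_polyC mulrA.
    by exists 0; rewrite zseq0; ring.
  by exists 0; rewrite zseq1; rewrite addrC subrK; ring.
have [n|z [zP zS]] := IH j.+1 (fun n => S n.+1).
  by have [q Eq] := SP n.+1; exists q; rewrite Eq addnS addSn.
have [q0 E0] := zS 0%N isT; have [q1 E1] := zS 1%N isT.
have [q Eq] := SP 0%N.
rewrite !addn0 addn1 in E0 E1 Eq.
have [chi' chiK] : exists c : O, c * chi = 1 by exists chi^-1; rewrite mulVr.
have chiK' : chi'%:P * chi%:P = 1 :> {poly O} by rewrite -polyCM chiK.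
(* [w] makes the recursion at index 0 exact: the errors add up to a multiple of
   [omega j.+2 = cyclo j.+1 * omega j.+1], and [chi] is a unit. *)
pose w := - chi'%:P * (q + q1 * cyclo j.+2 - a%:P * q0).
exists (fun n => if n is m.+1 then z m else S 0%N + w * omega j.+1); split=> [[|n]|[|n] nN].
- rewrite addn0 E0 E1 Eq (omegaS j.+1) (omegaS j) /w.
  transitivity (a%:P * (S 1%N + q0 * (cyclo j.+1 * omega j.+1)) - chi%:P * cyclo j.+1 * S 0%N
    + (chi'%:P * chi%:P) * (q + q1 * cyclo j.+2 - a%:P * q0) * (cyclo j.+1 * omega j.+1)); last ring.
  by rewrite chiK'; ring.
- by rewrite zP addnS addSn.
- by exists w; rewrite addn0.
- by have [r ->] := zS n nN; exists r; rewrite addnS addSn.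
Qed.

End Polynomials.

(** * Solving the recursion in the inverse limit *)

Lemma zseqB (O : idomainType) (a chi : O) (V : lmodType O) (phi : nat -> V -> V)
    (x y x' y' : V) n : (forall m u v, phi m (u - v) = phi m u - phi m v) ->
  zseq a chi phi (x - x') (y - y') n = zseq a chi phi x y n - zseq a chi phi x' y' n.
Proof.
move=> phiB.
have BB (t u v w : V) : t - u - (v - w) = t - v - (u - w).
  by rewrite !opprD !opprK addrACA.
suff: zseq a chi phi (x - x') (y - y') n = zseq a chi phi x y n - zseq a chi phi x' y' n
  /\ zseq a chi phi (x - x') (y - y') n.+1 =
     zseq a chi phi x y n.+1 - zseq a chi phi x' y' n.+1 by case.
elim: n => [|n [E1 E2]]; first by rewrite !zseq0 !zseq1 scalerBr addrACA opprD.
by split=> //; rewrite !zseqSS E1 E2 phiB !scalerBr BB.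
Qed.

Lemma zseq_closed (O : idomainType) (a chi : O) (V : lmodType O)
    (phi : nat -> V -> V) (A : set V) (x y : V) n :
  (forall u v, A u -> A v -> A (u + v)) -> (forall c u, A u -> A (c *: u)) ->
  (forall m u, A u -> A (phi m u)) -> A x -> A y -> A (zseq a chi phi x y n).
Proof.
move=> AD AZ Aphi Ax Ay.
suff: A (zseq a chi phi x y n) /\ A (zseq a chi phi x y n.+1) by case.
elim: n => [|n [E1 E2]]; first by split=> //; apply: AD => //; apply: AZ.
split=> //; rewrite zseqSS -scaleNr; apply: AD; apply: AZ => //.
exact: Aphi.
Qed.

Section PadicIntegers.
Variables (p : nat) (O : idomainType) (pi : O) (O_padic : padic_integers p pi).

Lemma adic_separated (x : O) : (forall k, adic pi (V := O^o) k x) -> x = 0.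
Proof.
move=> xk; apply/eqP/negPn/negP => x0.
have [u [k [u_unit Ex]]] := pi_uniformizer O_padic x0.
have [y Ey] := xk k.+1; have pi0 := pi_neq0 O_padic.
have : u = pi * y.
  apply: (mulIf (expf_neq0 k pi0)); rewrite -Ex Ey exprS.
  by change (pi * pi ^+ k * y = pi * y * pi ^+ k); ring.
move=> Eu; have := pi_nonunit O_padic; rewrite Eu unitrM in u_unit.
by case/andP: u_unit => ->.
Qed.

Lemma p_dvd : exists b, p%:R = pi * b.
Proof. by have [b ->] := residue_char O_padic; exists b; rewrite expr1. Qed.

End PadicIntegers.

Section Levels.
Variables (p : nat) (p_prime : prime p) (p_odd : odd p) (O : idomainType).
Local Notation gen n := (u_gen p_prime n).

Section Zseq.
Variables (a chi : O) (V : lmodType O).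

Definition zLV (m : nat) (x y : LV p_prime V m) : nat -> LV p_prime V m :=
  zseq a chi (fun k f => LV_scale (Phi p O k.+1) f) x y.

Lemma zLV0 m (x y : LV p_prime V m) : zLV x y 0 = x. Proof. by []. Qed.

Lemma zLVSS m (x y : LV p_prime V m) n :
  zLV x y n.+2 = a *: zLV x y n.+1 - chi *: LV_scale (Phi p O n.+1) (zLV x y n).
Proof. by []. Qed.

Lemma zLV_nbhs pi k m (x y : LV p_prime V m) n :
  LV_nbhs pi k x -> LV_nbhs pi k y -> LV_nbhs pi k (zLV x y n).
Proof.
apply: zseq_closed => [u v uk vk w|c u uk w|l u uk w].
- by rewrite ffunE; apply: adicD.
- by rewrite ffunE; apply: adicZ.
- rewrite LV_scale_Phi sum_ffunE.
  by elim/big_ind: _ => [|x' y'|j _]; [exact: adic0|exact: adicD|rewrite iter_LV_shift].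
Qed.

Lemma zLVB m (x y x' y' : LV p_prime V m) n :
  zLV (x - x') (y - y') n = zLV x y n - zLV x' y' n.
Proof. by apply: zseqB => *; apply: LV_scaleB. Qed.

Lemma zLV_pr m (x y : LV p_prime V m.+1) n :
  LV_pr (zLV x y n) = zLV (LV_pr x) (LV_pr y) n.
Proof.
apply: (zseq_morph _ _ _ _ (@LV_pr_linear p p_prime O V m)) => k f.
exact: LV_pr_scale.
Qed.

End Zseq.

Definition delta1 n : LV p_prime O^o n := [ffun u => (u == 1%g)%:R].

(* The quotient map O[T] -> O[T] / (omega n) = O[U n]. *)
Definition lev n (P : {poly O}) : LV p_prime O^o n :=
  poly_act (@LV_shift p p_prime O O^o n) P (delta1 n).

Let shift_linear n := @LV_shift_is_linear p p_prime O O^o n.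

Lemma levD n P Q : lev n (P + Q) = lev n P + lev n Q. Proof. exact: poly_actD. Qed.
Lemma levN n P : lev n (- P) = - lev n P. Proof. exact: poly_actN. Qed.
Lemma levB n P Q : lev n (P - Q) = lev n P - lev n Q.
Proof. by rewrite levD levN. Qed.
Lemma levM n P Q : lev n (P * Q) = poly_act (@LV_shift p p_prime O O^o n) P (lev n Q).
Proof. exact: poly_actM (@shift_linear n) P Q _. Qed.
Lemma levZ n c P : lev n (c%:P * P) = c *: lev n P.
Proof. by rewrite levM poly_actC. Qed.

Lemma lev_omega n Q : lev n (Q * omega p O n) = 0.
Proof.
rewrite mulrC levM poly_actD poly_actN poly_actXn poly_act1.
apply/ffunP=> u; rewrite !ffunE iter_LV_shift u_expgX // invg1 mul1g.
exact: subrr.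
Qed.

Lemma lev_coef n (P : {poly O}) i : (size P <= p ^ n.-1)%N -> (i < p ^ n.-1)%N ->
  lev n P (gen n ^+ i)%g = P`_i.
Proof.
move=> sP lt_i; rewrite /lev (poly_act_widen _ _ sP) sum_ffunE (bigD1 (Ordinal lt_i)) //=.
rewrite ffunE iter_LV_shift mulVg ffunE eqxx [_ *: _]mulr1 big1 ?addr0 // => j ji.
rewrite ffunE iter_LV_shift ffunE -eq_mulVg1.
case: eqP => [/u_gen_expg_eq Eji|_]; last exact: mulr0.
move: Eji; rewrite !modn_small // => Eji; case/eqP: ji; apply: val_inj.
exact: Eji.
Qed.

Lemma lev_eq0 n P : lev n P = 0 -> exists q, P = q * omega p O n.
Proof.
move=> P0; have W_mon := omega_monic p_prime O n.
set q := Pdiv.Ring.rdivp P (omega p O n); set s := Pdiv.Ring.rmodp P (omega p O n).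
have EP : P = q * omega p O n + s by exact: Pdiv.RingMonic.rdivp_eq.
exists q; rewrite EP; apply/eqP; rewrite addrC -subr_eq0 addrK; apply/eqP/polyP=> i.
have size_s : (size s <= p ^ n.-1)%N.
  by rewrite -ltnS -(size_omega p_prime O) Pdiv.Ring.ltn_rmodpN0 ?monic_neq0.
rewrite coef0; case: (ltnP i (p ^ n.-1)) => lt_i.
  rewrite -(lev_coef size_s lt_i); move: P0; rewrite EP levD lev_omega add0r => ->.
  by rewrite ffunE.
by rewrite nth_default // (leq_trans size_s).
Qed.

Lemma lev_surj n (f : LV p_prime O^o n) : exists P, lev n P = f.
Proof.
exists (\poly_(i < p ^ n.-1) f (gen n ^+ i)%g); apply/ffunP=> u.
have [i lt_i ->] := u_gen_expgP p_odd u.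
by rewrite lev_coef ?size_poly // coef_poly lt_i.
Qed.

Lemma lev_pr n P : LV_pr (lev n.+1 P) = lev n P.
Proof.
rewrite /lev (@poly_act_morph _ _ _ _ (@LV_shift p p_prime O O^o n) (@LV_pr p p_prime O O^o n)).
- congr poly_act; apply/ffunP=> u; rewrite !ffunE.
  have red1 : u_red (1 : U p_prime n.+1)%g = 1%g.
    by rewrite -(expg0 (gen n.+1)) u_red_gen_expg.
  have [->|u1] := eqVneq u 1%g.
    rewrite (bigD1 1%g) ?red1 //= ffunE eqxx big1 ?addr0 // => v /andP [_ v1].
    by rewrite ffunE (negPf v1).
  rewrite big1 // => v /eqP vu; rewrite ffunE.
  by case: eqP => // v1; move: u1; rewrite -vu v1 red1 eqxx.
- exact: LV_pr_linear.
- exact: LV_pr_shift.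
Qed.

Lemma lev_Phi n k P : LV_scale (Phi p O k) (lev n P) = lev n (cyclo p O k * P).
Proof.
rewrite levM LV_scale_Phi poly_act_sum; apply: eq_bigr => j _.
by rewrite poly_actXn.
Qed.

Lemma lev_tr n P : LV_tr (lev n.+1 P) = lev n.+2 (cyclo p O n.+1 * P).
Proof. by rewrite -lev_pr LV_tr_pr // lev_Phi. Qed.

Lemma lev_zseq m a chi P Q n :
  lev m (zseq a chi (fun k f => cyclo p O k.+1 * f) P Q n) =
  zLV a chi (lev m P) (lev m Q) n.
Proof.
apply: zseq_morph => [c f g|k f]; last by rewrite lev_Phi.
by rewrite levD -mul_polyC levZ.
Qed.

Variables (pi a chi : O) (O_padic : padic_integers p pi).

Lemma lev_near0P k n P : near0 p pi k n P <-> LV_nbhs pi k (lev n P).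
Proof.
split=> [[q [r ->]] u|Pk].
  rewrite levD lev_omega add0r levZ ffunE; by exists (lev n r u).
have /choice [g gP] := Pk.
have [r Er] := @lev_surj n [ffun u => g u].
have [|q Eq] := @lev_eq0 n (P - (pi ^+ k)%:P * r).
  by rewrite levB levZ Er; apply/ffunP=> u; rewrite !ffunE gP subrr.
by exists q, r; rewrite -Eq subrK.
Qed.

Hypotheses (chi_unit : chi \is a GRing.unit) (a_pi : exists b, a = pi * b).

Lemma LVoo_lev (x : LVoo p_prime O^o) N P : x N = lev N P ->
  forall i, (i <= N)%N -> x i = lev i P.
Proof.
move=> xN i iN; rewrite -(subKn iN); elim: (N - i)%N (leq_subr i N) => [|j IH] jN.
  by rewrite subn0.
have {}IH := IH (ltnW jN); rewrite -(subnSK jN) in IH.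
by rewrite -(lv_compat x) IH lev_pr.
Qed.

(** Polynomial lifts of [x] and [y] from level [N.+1] represent all lower levels too, and their
    [zseq] satisfies the recursion exactly, so [zrec_near0] applies. *)
Lemma zLV_estimate_regular (x y : LVoo p_prime O^o) N l k i :
  (forall n, (n <= N)%N -> LV_nbhs pi l (zLV a chi (x n.+1) (y n.+1) n)) ->
  (k <= l)%N -> (i + 2 * k < N)%N -> LV_nbhs pi k (x i) /\ LV_nbhs pi k (y i).
Proof.
move=> xy_small kl iN.
have [P /esym EP] := lev_surj (x N.+1); have [Q /esym EQ] := lev_surj (y N.+1).
have {}EP := LVoo_lev EP; have {}EQ := LVoo_lev EQ.
pose z := zseq a chi (fun k f => cyclo p O k.+1 * f) P Q.
have zP : zrec p a chi 0 z by move=> n; rewrite /z zseqSS -!mul_polyC mulrA.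
have [|z0 z1] := zrec_near0 p_prime (pi_neq0 O_padic) chi_unit a_pi
    (p_dvd O_padic) (N := N) zP _ kl iN.
  move=> n nN; apply/lev_near0P; rewrite lev_zseq -(EP n.+1 nN) -(EQ n.+1 nN).
  exact: xy_small.
have iN1 : (i <= N.+1)%N by lia.
rewrite EP // EQ //; split; apply/lev_near0P => //.
have -> : Q = z 1%N + (- a%:P) * z 0%N by rewrite /z zseq1 zseq0 -mul_polyC; ring.
by apply: near0D => //; apply: near0M.
Qed.

(** The limit is taken coefficientwise in the complete ring O. The rate [i + 2 * k] is the one
    supplied by [zrec_near0]. *)
Lemma LVoo_limit (w : nat -> {poly O}) :
  (forall k i M N, (i + 2 * k <= M)%N -> (i + 2 * k <= N)%N ->
     near0 p pi k i (w M - w N)) ->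
  exists x : LVoo p_prime O^o, forall k i N, (i + 2 * k <= N)%N ->
    LV_nbhs pi k (x i - lev i (w N)).
Proof.
move=> w_cauchy.
have L_ex i : exists L : LV p_prime O^o i, forall k,
    LV_nbhs pi k (L - lev i (w (i + 2 * k)%N)).
  have /choice [l lP] (u : U p_prime i) : exists y : O^o, forall k,
      adic pi (V := O^o) k (y - lev i (w (i + 2 * k)%N) u).
    apply: (pi_complete O_padic (x := fun k => lev i (w (i + 2 * k)%N) u)) => k.
    have /lev_near0P/(_ u) := w_cauchy k i (i + 2 * k.+1)%N (i + 2 * k)%N ltac:(lia) ltac:(lia).
    by rewrite levB !ffunE.
  by exists [ffun u => l u] => k u; rewrite !ffunE.
pose L i := sval (cid (L_ex i)).
have LP i k : LV_nbhs pi k (L i - lev i (w (i + 2 * k)%N)) by apply: (svalP (cid (L_ex i))).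
have LP' k i N : (i + 2 * k <= N)%N -> LV_nbhs pi k (L i - lev i (w N)).
  move=> iN; have /lev_near0P := w_cauchy k i N (i + 2 * k)%N iN (leqnn _).
  rewrite levB => wk; have := LV_nbhsB (LP i k) wk.
  by rewrite opprB addrA subrK.
have L_compat i : LV_pr (L i.+1) = L i.
  apply/ffunP=> u; apply/eqP; rewrite -subr_eq0; apply/eqP/(adic_separated O_padic) => k.
  have h1 := LP' k i.+1 (i.+1 + 2 * k)%N (leqnn _).
  have h2 := LP' k i (i.+1 + 2 * k)%N ltac:(lia).
  have h3 : LV_nbhs pi k (LV_pr (L i.+1 - lev i.+1 (w (i.+1 + 2 * k)%N))).
    move=> v; rewrite ffunE; elim/big_ind: _ => [|? ?|? _]; [exact: adic0|exact: adicD|exact: h1].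
  rewrite LV_prB lev_pr in h3; have := LV_nbhsB h3 h2 u.
  by rewrite opprB addrA subrK !ffunE.
by exists (MkLVoo L_compat) => k i N iN; apply: LP'.
Qed.

(** Polynomial lifts of the [s n.+1] satisfy the recursion only modulo the omega; [zrec_lift]
    replaces them by exact solutions [z N], correct up to index [N.+1], whose initial terms
    converge. *)
Lemma zLV_solve_regular (s : forall n, LV p_prime O^o n) :
  (forall n, LV_pr (s n.+3) = a *: s n.+2 - chi *: LV_tr (s n.+1)) ->
  exists x y : LVoo p_prime O^o, forall n, zLV a chi (x n.+1) (y n.+1) n = s n.+1.
Proof.
move=> sP.
have /choice [S SP] n : exists P, lev n.+1 P = s n.+1 by exact: lev_surj.
have S_rec n : exists q, S n.+2 = a%:P * S n.+1 - chi%:P * cyclo p O (0 + n).+1 * S n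
                                + q * omega p O (0 + n).+2.
  have [|q Eq] := @lev_eq0 n.+2 (S n.+2 - (a%:P * S n.+1 - chi%:P * cyclo p O n.+1 * S n)).
    rewrite levB -lev_pr SP sP levB -mulrA !levZ SP -lev_tr SP; exact: subrr.
  by exists q; rewrite -Eq addrC subrK.
have /choice [z zP] N := zrec_lift chi_unit N S_rec.
have z_rec N : zrec p a chi 0 (z N) by case: (zP N).
have z_lev N n : (n <= N.+1)%N -> lev n.+1 (z N n) = s n.+1.
  by move=> nN; case: (zP N) => _ /(_ n nN) [q ->]; rewrite levD lev_omega SP addr0.
(* The difference of two exact solutions solves the recursion, and its term [n] vanishes at level
   [n.+1] for [n] up to [(i + 2 * k).+1]. *)
have z_cauchy k i M N : (i + 2 * k <= M)%N -> (i + 2 * k <= N)%N ->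
    near0 p pi k i (z M 0 - z N 0) /\ near0 p pi k i (z M 1 - z N 1).
  move=> iM iN.
  apply: (zrec_near0 p_prime (pi_neq0 O_padic) chi_unit a_pi (p_dvd O_padic)
    (z := fun n => z M n - z N n) (N := (i + 2 * k).+1) (l := k)) => // [n|n ni].
    by rewrite !z_rec; ring.
  apply/lev_near0P; rewrite levB !z_lev ?subrr; try lia.
  exact: LV_nbhs0.
have [x xP] : exists x : LVoo p_prime O^o, forall k i N, (i + 2 * k <= N)%N ->
    LV_nbhs pi k (x i - lev i (z N 0)).
  by apply: LVoo_limit => k i M N iM iN; case: (z_cauchy k i M N iM iN).
have [y yP] : exists y : LVoo p_prime O^o, forall k i N, (i + 2 * k <= N)%N ->
    LV_nbhs pi k (y i - lev i (z N 1 - a *: z N 0)).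
  apply: LVoo_limit => k i M N iM iN; have [h0 h1] := z_cauchy k i M N iM iN.
  have -> : z M 1 - a *: z M 0 - (z N 1 - a *: z N 0) =
     (z M 1 - z N 1) + (- a%:P) * (z M 0 - z N 0) by rewrite -!mul_polyC; ring.
  by apply: near0D => //; apply: near0M.
exists x, y => n; apply/ffunP=> u; apply/eqP; rewrite -subr_eq0.
apply/eqP/(adic_separated O_padic) => k; set N := (n.+1 + 2 * k)%N.
have E : lev n.+1 (z N n) = zLV a chi (lev n.+1 (z N 0)) (lev n.+1 (z N 1 - a *: z N 0)) n.
  rewrite -lev_zseq (@zseq_unique _ a chi _ _ (z N) n.+1 _ n (leqnSn n) isT) // => m _.
  by rewrite z_rec -!mul_polyC mulrA.
rewrite z_lev in E; last by rewrite /N; lia.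
have := zLV_nbhs a chi n (xP k n.+1 N (leqnn _)) (yP k n.+1 N (leqnn _)) u.
by rewrite zLVB -E !ffunE.
Qed.

End Levels.

(** * Passage from O to matrices over O, entry by entry *)

Section MatrixCoefficients.
Variables (p : nat) (p_prime : prime p) (p_odd : odd p) (O : idomainType).
Variables (pi a chi : O) (O_padic : padic_integers p pi) (r c : nat).
Local Notation V := 'M[O]_(r, c).

Lemma adic_mxP k (A : V) : adic pi k A <-> forall i j, adic pi (V := O^o) k (A i j).
Proof.
split=> [[B ->] i j|Ak]; first by exists (B i j); rewrite mxE.
have /choice [b bP] (ij : 'I_r * 'I_c) : exists y, A ij.1 ij.2 = pi ^+ k * y.
  exact: Ak.
by exists (\matrix_(i, j) b (i, j)); apply/matrixP=> i j; rewrite !mxE -bP.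
Qed.

Lemma mx_separated (A : V) : (forall k, adic pi k A) -> A = 0.
Proof.
move=> Ak; apply/matrixP=> i j; rewrite mxE; apply: (adic_separated O_padic) => k.
by have /adic_mxP := Ak k.
Qed.

Definition lco i j n (f : LV p_prime V n) : LV p_prime O^o n := [ffun u => f u i j].

Lemma lco_linear i j n : linear (@lco i j n).
Proof. by move=> b f g; apply/ffunP=> u; rewrite !ffunE !mxE. Qed.

Lemma lcoB i j n f g : @lco i j n (f - g) = lco i j f - lco i j g.
Proof. by apply/ffunP=> u; rewrite !ffunE !mxE. Qed.

Lemma lcoZ i j n b f : @lco i j n (b *: f) = b *: lco i j f.
Proof. by apply/ffunP=> u; rewrite !ffunE !mxE. Qed.

Lemma lco_pr i j n f : lco i j (@LV_pr p p_prime O V n f) = LV_pr (lco i j f).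
Proof.
apply/ffunP=> u; rewrite !ffunE summxE.
by apply: eq_bigr => v _; rewrite ffunE.
Qed.

Lemma lco_tr i j n f : lco i j (@LV_tr p p_prime O V n f) = LV_tr (lco i j f).
Proof. by apply/ffunP=> u; rewrite !ffunE. Qed.

Lemma lco_scale i j n P f : lco i j (@LV_scale p p_prime O V n P f) = LV_scale P (lco i j f).
Proof.
apply: (poly_act_morph _ _ (@lco_linear i j n)) => g.
by apply/ffunP=> u; rewrite !ffunE !mxE.
Qed.

Lemma lco_zLV i j m (x y : LV p_prime V m) n :
  lco i j (zLV a chi x y n) = zLV a chi (lco i j x) (lco i j y) n.
Proof. by apply: zseq_morph => [|k f]; [exact: lco_linear|exact: lco_scale]. Qed.

Lemma LV_nbhs_lcoP k n (f : LV p_prime V n) :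
  LV_nbhs pi k f <-> forall i j, LV_nbhs pi k (lco i j f).
Proof.
split=> [fk i j u|fk u]; first by rewrite ffunE; have /adic_mxP := fk u.
by apply/adic_mxP=> i j; have := fk i j u; rewrite ffunE.
Qed.

Lemma lco_inj n (f g : LV p_prime V n) : (forall i j, lco i j f = lco i j g) -> f = g.
Proof.
move=> fg; apply/ffunP=> u; apply/matrixP=> i j.
by have /ffunP/(_ u) := fg i j; rewrite !ffunE.
Qed.

Definition lcoo i j (x : LVoo p_prime V) : LVoo p_prime O^o :=
  @MkLVoo _ _ _ _ (fun n => lco i j (x n))
    (fun n => etrans (esym (lco_pr i j (x n.+1))) (congr1 _ (lv_compat x n))).

Lemma lcoo_surj (y : 'I_r -> 'I_c -> LVoo p_prime O^o) :
  exists x : LVoo p_prime V, forall i j n, lco i j (x n) = y i j n.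
Proof.
pose x n : LV p_prime V n := [ffun u => \matrix_(i, j) y i j n u].
have xE i j n : lco i j (x n) = y i j n.
  by apply/ffunP=> u; rewrite !ffunE !mxE.
have x_compat n : LV_pr (x n.+1) = x n.
  by apply: lco_inj => i j; rewrite lco_pr !xE lv_compat.
by exists (MkLVoo x_compat).
Qed.

Hypotheses (chi_unit : chi \is a GRing.unit) (a_pi : exists b, a = pi * b).

Lemma zLV_estimate (x y : LVoo p_prime V) N l k i :
  (forall n, (n <= N)%N -> LV_nbhs pi l (zLV a chi (x n.+1) (y n.+1) n)) ->
  (k <= l)%N -> (i + 2 * k < N)%N -> LV_nbhs pi k (x i) /\ LV_nbhs pi k (y i).
Proof.
move=> xy_small kl iN.
have xy i' j' : LV_nbhs pi k (lcoo i' j' x i) /\ LV_nbhs pi k (lcoo i' j' y i).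
  apply: (zLV_estimate_regular p_odd O_padic chi_unit a_pi _ kl iN) => n nN.
  by rewrite /= -lco_zLV; have /LV_nbhs_lcoP := xy_small n nN.
by split; apply/LV_nbhs_lcoP => i' j'; case: (xy i' j').
Qed.

Lemma zLV_eq0 (x y : LVoo p_prime V) :
  (forall n, zLV a chi (x n.+1) (y n.+1) n = 0) -> x = 0 /\ y = 0.
Proof.
move=> xy0; suff xy i u k : adic pi k (x i u) /\ adic pi k (y i u).
  by split; apply: LVoo_eq => i; apply/ffunP=> u; rewrite [RHS]ffunE;
     apply: mx_separated => k; case: (xy i u k).
have [|xk yk] := @zLV_estimate x y (i + 2 * k).+1 k k i _ (leqnn _) (leqnn _).
  by move=> n _; rewrite xy0; apply: LV_nbhs0.
by split; [apply: xk|apply: yk].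
Qed.

Lemma zLV_solve (s : forall n, LV p_prime V n) :
  (forall n, LV_pr (s n.+3) = a *: s n.+2 - chi *: LV_tr (s n.+1)) ->
  exists x y : LVoo p_prime V, forall n, zLV a chi (x n.+1) (y n.+1) n = s n.+1.
Proof.
move=> sP.
have /choice [xy xyP] (ij : 'I_r * 'I_c) : exists xy : LVoo p_prime O^o * LVoo p_prime O^o,
    forall n, zLV a chi (xy.1 n.+1) (xy.2 n.+1) n = lco ij.1 ij.2 (s n.+1).
  have [|x [y xyP]] := zLV_solve_regular p_odd O_padic chi_unit a_pi
    (s := fun n => lco ij.1 ij.2 (s n)).
    by move=> n; rewrite -lco_pr sP lcoB !lcoZ lco_tr.
  by exists (x, y).
have [x xE] := lcoo_surj (fun i j => (xy (i, j)).1).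
have [y yE] := lcoo_surj (fun i j => (xy (i, j)).2).
by exists x, y => n; apply: lco_inj => i j; rewrite lco_zLV xE yE xyP.
Qed.

End MatrixCoefficients.

(** * Cocycles and classes *)

Section Classes.
Variables (G : set GQ) (A : gmodule).

Lemma H1_eqP (c c' : Z1 G A) : H1_class c = H1_class c' <->
  exists a : A, forall s, G s -> c s - c' s = gm_act s a - a.
Proof.
split=> [E|[a Ea]].
  have : (c - c') \in @B1 G A by rewrite Quotient.idealrBE; apply/eqP.
  by move/asboolP.
have : (c - c') \in @B1 G A by apply/asboolP; exists a.
by rewrite Quotient.idealrBE => /eqP.
Qed.

Lemma z1B (c c' : Z1 G A) s : (c - c') s = c s - c' s. Proof. by []. Qed.

Lemma H1_reprK (x : H1 G A) : H1_class (H1_repr x) = x.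
Proof. exact: generic_quotient.reprK. Qed.

Lemma H1_class_surj (x : H1 G A) : exists c : Z1 G A, H1_class c = x.
Proof. by exists (H1_repr x); apply: H1_reprK. Qed.

Lemma H1_classD (c c' : Z1 G A) : H1_class (c + c') = H1_class c + H1_class c'.
Proof. exact: Quotient.pi_add. Qed.

Lemma H1_classN (c : Z1 G A) : H1_class (- c) = - H1_class c.
Proof. exact: Quotient.pi_opp. Qed.

Lemma H1_classB (c c' : Z1 G A) : H1_class (c - c') = H1_class c - H1_class c'.
Proof. by rewrite H1_classD H1_classN. Qed.

End Classes.

Lemma Z1_mapE (G : set GQ) (A B : gmodule) (f : ghom A B) (c : Z1 G A) s :
  Z1_map f c s = f (c s).
Proof. by []. Qed.

(** The representative chosen by [H1_map] differs from [c] by the coboundary of some [a], which [f]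
    sends to that of [f a]. *)
Lemma H1_map_class (G : set GQ) (A B : gmodule) (f : ghom A B) (c : Z1 G A) :
  H1_map f (H1_class c) = H1_class (Z1_map f c).
Proof.
have /H1_eqP [a Ea] := H1_reprK (H1_class c).
apply/H1_eqP; exists (f a) => s Gs /=.
by rewrite -gh_act -!ghB Ea.
Qed.

Section Cohomology.
Variables (p : nat) (p_prime : prime p) (O : idomainType) (pi : O).
Variables (V : lmodType O) (act : GQ -> {linear V -> V}) (kac : GQ -> oneZp p_prime).
Variables (G : set GQ).
Hypotheses
  (act_mul : forall s t v, G s -> G t -> act (Defs.gal_mul s t) v = act s (act t v))
  (kac_mul : forall n s t, G s -> G t -> kac (Defs.gal_mul s t) n = (kac s n * kac t n)%g)
  (act_cont : forall k v s, G s -> exists X : seq algC,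
    forall t, G t -> {in X, s =1 t} -> adic pi k (act t v - act s v))
  (kac_cont : forall n s, G s -> exists X : seq algC,
    forall t, G t -> {in X, s =1 t} -> kac t n = kac s n).

Lemma LV_act_mul n s t (f : LV p_prime V n) : G s -> G t ->
  LV_act act kac (Defs.gal_mul s t) f = LV_act act kac s (LV_act act kac t f).
Proof.
move=> Gs Gt; apply/ffunP=> u; rewrite !ffunE act_mul // kac_mul //.
by rewrite (u_mulC (kac s n)) mulgA.
Qed.

Lemma LV_act_cont n k (f : LV p_prime V n) s : G s -> exists X : seq algC,
  forall t, G t -> {in X, s =1 t} ->
    LV_nbhs pi k (LV_act act kac t f - LV_act act kac s f).
Proof.
move=> Gs; have [X0 X0P] := kac_cont n Gs.
have /choice [X XP] (u : U p_prime n) := act_cont k (f u) Gs.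
exists (X0 ++ flatten [seq X u | u <- enum (U p_prime n)]) => t Gt st u.
rewrite !ffunE X0P //; last by move=> x x0; apply: st; rewrite mem_cat x0.
apply: XP => // x xX; apply: st; rewrite mem_cat; apply/orP; right.
by apply/flattenP; exists (X (kac s n * u)%g) => //; apply: map_f; rewrite mem_enum.
Qed.

(** A [gmodule] includes neither the laws of an action nor its continuity; on [G] they come from the
    hypotheses of the section. *)
Lemma coboundary_subproof n (b : LV p_prime V n) :
  (fun s => LV_act act kac s b - b) \in @Z1_pred G (LV_mod pi act kac n).
Proof.
apply/asboolP; split=> [s t Gs Gt|k s Gs].
  change (LV_act act kac (Defs.gal_mul s t) b - b =
    LV_act act kac s b - b + LV_act act kac s (LV_act act kac t b - b)).
  by rewrite LV_act_mul // LV_actB [RHS]addrC addrA subrK.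
have [X XP] := LV_act_cont k b Gs; exists X => t Gt st.
change (LV_nbhs pi k (LV_act act kac t b - b - (LV_act act kac s b - b))).
by rewrite opprB addrA subrK; apply: XP.
Qed.

Definition coboundary n (b : LV p_prime V n) : Z1 G (LV_mod pi act kac n) :=
  MkZ1 (coboundary_subproof b).

Lemma H1_class_coboundary n (b : LV p_prime V n) (c : Z1 G (LV_mod pi act kac n)) :
  H1_class (c - coboundary b) = H1_class c.
Proof.
apply/H1_eqP; exists (- b) => s _.
change (c s - (LV_act act kac s b - b) - c s = LV_act act kac s (- b) - - b).
rewrite addrAC subrr add0r opprB opprK.
have -> : LV_act act kac s (- b) = - LV_act act kac s b.
  have h0 : LV_act act kac s 0 = 0 :> LV p_prime V n.
    by have := LV_actB act kac s b b; rewrite !subrr.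
  by have := LV_actB act kac s 0 b; rewrite h0 !sub0r.
by rewrite addrC.
Qed.

End Cohomology.

Section ClassMaps.
Variables (p : nat) (p_prime : prime p) (O : idomainType) (pi : O).
Variables (V : lmodType O) (act : GQ -> {linear V -> V}) (kac : GQ -> oneZp p_prime).
Variables (G : set GQ) (n : nat).

Lemma pr_class (c : Z1 G (LV_mod pi act kac n.+1)) :
  pr (H1_class c : H1n pi act kac G n.+1) = H1_class (Z1_map (LV_pr_hom pi act kac n) c).
Proof. exact: H1_map_class. Qed.

Lemma Tr_class (c : Z1 G (LV_mod pi act kac n)) :
  Tr (H1_class c : H1n pi act kac G n) = H1_class (Z1_map (LV_tr_hom pi act kac n) c).
Proof. exact: H1_map_class. Qed.

Lemma pr_oo_class (c : Z1 G (LVoo_mod pi act kac)) :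
  pr_oo n (H1_class c : H1oo pi act kac G) = H1_class (Z1_map (LVoo_pr_hom pi act kac n) c).
Proof. exact: H1_map_class. Qed.

Lemma scale_class P (c : Z1 G (LV_mod pi act kac n)) :
  scale P (H1_class c : H1n pi act kac G n) =
    H1_class (Z1_map (LV_scale_hom pi act kac n P) c).
Proof. exact: H1_map_class. Qed.

End ClassMaps.

(** * Rows of the product C_{g,n} ... C_{g,1} *)

Section MatrixRows.
Variables (p : nat) (p_prime : prime p) (O : idomainType) (V : lmodType O) (a chi : O).
Variables (m : nat) (x y : LV p_prime V m).
Local Notation row C i := (LV_scale (C i ord0) x + LV_scale (C i ord_max) y).

Lemma Cg_prod_row1 n :
  row (Cg_prod p a chi n.+1) ord_max =
    - (chi *: LV_scale (Phi p O n.+1) (row (Cg_prod p a chi n) ord0)).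
Proof.
have E j : Cg_prod p a chi n.+1 ord_max j =
    - (chi%:P * (Phi p O n.+1 * Cg_prod p a chi n ord0 j)).
  by rewrite /= mxE big_ord_recl big_ord1 !mxE /= mul0r addr0 mulrA !mulNr.
rewrite !E !LV_scaleN !LV_scaleM !LV_scaleC -opprD -scalerDr.
have S2 : LV_scale (Phi p O n.+1) (row (Cg_prod p a chi n) ord0) =
    LV_scale (Phi p O n.+1) (LV_scale (Cg_prod p a chi n ord0 ord0) x) +
    LV_scale (Phi p O n.+1) (LV_scale (Cg_prod p a chi n ord0 ord_max) y).
  rewrite -[LV_scale (Cg_prod _ _ _ _ _ ord0) x in LHS]scale1r LV_scale_linear.
  by rewrite scale1r.
by rewrite S2.
Qed.

Lemma Cg_prod_row0S n :
  row (Cg_prod p a chi n.+1) ord0 =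
    a *: row (Cg_prod p a chi n) ord0 + row (Cg_prod p a chi n) ord_max.
Proof.
have E j : Cg_prod p a chi n.+1 ord0 j =
    a%:P * Cg_prod p a chi n ord0 j + Cg_prod p a chi n ord_max j.
  rewrite /= mxE big_ord_recl big_ord1 !mxE /= mul1r.
  by congr (_ + Cg_prod _ _ _ _ _ _); apply: val_inj.
by rewrite !E !LV_scaleD !LV_scaleM !LV_scaleC scalerDr addrACA.
Qed.

(** Eliminating the second row from [Cg_prod_row0S] and [Cg_prod_row1] leaves the three-term
    recursion of [zLV]. *)
Lemma Cg_prod_row0 n : row (Cg_prod p a chi n) ord0 = zLV a chi x y n.
Proof.
have row00 : row (Cg_prod p a chi 0) ord0 = x.
  by rewrite /= !mxE /= LV_scaleC scale1r LV_scaleC scale0r addr0.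
have row01 : row (Cg_prod p a chi 0) ord_max = y.
  by rewrite /= !mxE /= LV_scaleC scale0r LV_scaleC scale1r add0r.
suff: row (Cg_prod p a chi n) ord0 = zLV a chi x y n /\
    row (Cg_prod p a chi n.+1) ord0 = zLV a chi x y n.+1 by case.
elim: n => [|n [E1 E2]]; first by rewrite Cg_prod_row0S row00 row01.
split=> //; rewrite Cg_prod_row0S E2 Cg_prod_row1 E1.
by rewrite zLVSS.
Qed.

End MatrixRows.

(** * Decomposition of compatible families of classes *)

Lemma subrBAC (W : zmodType) (x y z t : W) : x - y - (z - t) = x - z - (y - t).
Proof. by rewrite !opprD !opprK addrACA. Qed.

(** Bookkeeping for [recursive_cocycles]: [f], [y'], [z'] are the images of [f'], [y0], [z0] under a
    Galois element, while [y] and [z] come from cocycle values. *)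
Lemma adjust_identity (R : nzRingType) (W : lmodType R) (a b : R) (f f' y y' y0 z z' z0 : W) :
  f - f' + (a *: y - b *: z) - (f + (a *: y' - b *: z') - (f' + (a *: y0 - b *: z0))) =
    a *: (y - (y' - y0)) - b *: (z - (z' - z0)).
Proof.
have -> : f + (a *: y' - b *: z') - (f' + (a *: y0 - b *: z0)) =
    f - f' + ((a *: y' - b *: z') - (a *: y0 - b *: z0)) by rewrite opprD addrACA.
rewrite opprD addrACA subrr add0r !scalerBr [RHS]subrBAC; congr (_ - _).
exact: subrBAC.
Qed.

Section Decomposition.
Variables (p : nat) (p_prime : prime p) (p_odd : odd p) (O : idomainType).
Variables (pi a chi : O) (O_padic : padic_integers p pi) (r c : nat).
Hypotheses (chi_unit : chi \is a GRing.unit) (a_pi : exists b, a = pi * b).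
Local Notation V := 'M[O]_(r, c).
Variables (act : GQ -> {linear V -> V}) (kac : GQ -> oneZp p_prime).
Variables (G : set GQ).
Hypotheses (G_mul : forall s t, G s -> G t -> G (Defs.gal_mul s t))
  (act_mul : forall s t v, G s -> G t -> act (Defs.gal_mul s t) v = act s (act t v))
  (kac_mul : forall n s t, G s -> G t -> kac (Defs.gal_mul s t) n = (kac s n * kac t n)%g)
  (act_cont : forall k v s, G s -> exists X : seq algC,
    forall t, G t -> {in X, s =1 t} -> adic pi k (act t v - act s v))
  (kac_cont : forall n s, G s -> exists X : seq algC,
    forall t, G t -> {in X, s =1 t} -> kac t n = kac s n)
  (H0_trivial : forall n (f : LV p_prime V n),
    (forall s, G s -> LV_act act kac s f = f) -> f = 0).

Local Notation LV := (LV p_prime V).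
Local Notation LVn n := (LV_mod pi act kac n).
Local Notation LVinf := (LVoo_mod pi act kac).
Local Notation H1n := (H1n pi act kac G).
Local Notation H1oo := (H1oo pi act kac G).
Local Notation scale := (@scale p p_prime O pi V act kac G).
Local Notation Tr := (@Tr p p_prime O pi V act kac G).
Local Notation pr := (@pr p p_prime O pi V act kac G).
Local Notation pr_oo := (@pr_oo p p_prime O pi V act kac G).
Local Notation zLV := (zLV a chi).
Local Notation actn := (LV_act act kac).

Lemma LV_act_linear n s : linear (@LV_act p p_prime O V act kac n s).
Proof. by move=> b f g; apply/ffunP=> u; rewrite !ffunE linearP. Qed.

Lemma zLV_act m s (x y : LV m) n : actn s (zLV x y n) = zLV (actn s x) (actn s y) n.
Proof.
apply: zseq_morph => [|k f]; first exact: LV_act_linear.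
by rewrite LV_scale_act.
Qed.

Lemma recursion_adjust (t : forall n, LV n.+2) : exists b : forall n, LV n,
  forall n, LV_pr (b n.+3) = t n + (a *: b n.+2 - chi *: LV_tr (b n.+1)).
Proof.
pose sec n (f : LV n) : LV n.+1 := sval (cid (LV_pr_surj f)).
have secK n (f : LV n) : LV_pr (sec n f) = f by exact: svalP (cid (LV_pr_surj f)).
(* The pair holds [b n.+1] and [b n.+2]; each new term is a chosen preimage under [LV_pr]. *)
pose fix bp n : LV n.+1 * LV n.+2 :=
  if n is m.+1 return LV n.+1 * LV n.+2 then
    ((bp m).2, sec _ (t m + (a *: (bp m).2 - chi *: LV_tr (bp m).1)))
  else (0, 0).
exists (fun n => if n is m.+1 return LV n then (bp m).1 else 0) => n.
exact: secK.
Qed.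

(* The recursion holds only up to coboundaries for arbitrary representatives
   of the classes, and these are absorbed because [LV_pr] is surjective. *)
Lemma recursive_cocycles (kappa : forall n, H1n n) :
  (forall n, pr (kappa n.+3) = scale a%:P (kappa n.+2) - scale chi%:P (Tr (kappa n.+1))) ->
  exists z : forall n, Z1 G (LVn n), (forall n, H1_class (z n) = kappa n) /\
    forall n s, G s -> LV_pr (z n.+3 s) = a *: (z n.+2 s : LV _) - chi *: LV_tr (z n.+1 s).
Proof.
move=> kappaP.
have [z zE] : exists z : forall n, Z1 G (LVn n), forall n, H1_class (z n) = kappa n.
  by exists (fun n => H1_repr (kappa n)) => n; exact: H1_reprK.
(* The failure of the recursion for the chosen representatives is the coboundary of [t]. *)
have t_ex n : exists t : LV n.+2, forall s, G s ->
    LV_pr (z n.+3 s) - (a *: (z n.+2 s : LV _) - chi *: LV_tr (z n.+1 s)) = actn s t - t.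
  have := kappaP n; rewrite -!zE pr_class Tr_class !scale_class.
  rewrite -H1_classB => /H1_eqP [t tP]; exists t => s Gs.
  have := tP s Gs; rewrite !z1B !Z1_mapE => <-.
  rewrite -(LV_scaleC a (z n.+2 s : LV _)) -(LV_scaleC chi (LV_tr (z n.+1 s))).
  by [].
pose t n := sval (cid (t_ex n)).
have tP n s : G s -> LV_pr (z n.+3 s) - (a *: (z n.+2 s : LV _) - chi *: LV_tr (z n.+1 s))
    = actn s (t n) - t n by exact: svalP (cid (t_ex n)) s.
have [b bP] := recursion_adjust t.
exists (fun n => z n - coboundary act_mul kac_mul act_cont kac_cont (b n)).
split=> [n|n s Gs]; first by rewrite H1_class_coboundary.
change (LV_pr ((z n.+3 s : LV _) - (actn s (b n.+3) - b n.+3)) =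
  a *: ((z n.+2 s : LV _) - (actn s (b n.+2) - b n.+2))
  - chi *: LV_tr ((z n.+1 s : LV _) - (actn s (b n.+1) - b n.+1))).
rewrite !LV_prB LV_pr_act bP !LV_trB LV_tr_act.
have actD : {morph (@LV_act p p_prime O V act kac n.+2 s) : f g / f + g}.
  by move=> f g; apply/ffunP=> u; rewrite !ffunE linearD.
have actB f g : actn s (f - g) = actn s f - actn s g := LV_actB _ _ _ f g.
have actZ d f : actn s (d *: f) = d *: actn s f :> LV n.+2.
  by apply/ffunP=> u; rewrite !ffunE linearZ.
have E : LV_pr (z n.+3 s) = actn s (t n) - t n + (a *: (z n.+2 s : LV _) - chi *: LV_tr (z n.+1 s)).
  by apply/eqP; rewrite -subr_eq; apply/eqP/tP.
by rewrite E actD actB !actZ; apply: adjust_identity.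
Qed.

Lemma mat_act_class (m n : nat) (x y : Z1 G LVinf) (w0 w1 : Z1 G (LVn m)) :
  mat_act (Cg_prod p a chi n) (pr_oo m (H1_class x), pr_oo m (H1_class y)) =
    (H1_class w0, H1_class w1) <->
  (exists b : LV m, forall s, G s -> zLV (x s m) (y s m) n - w0 s = actn s b - b) /\
  (exists b : LV m, forall s, G s ->
     LV_scale (Cg_prod p a chi n ord_max ord0) (x s m)
     + LV_scale (Cg_prod p a chi n ord_max ord_max) (y s m) - w1 s = actn s b - b).
Proof.
rewrite !pr_oo_class /mat_act /= !scale_class -!H1_classD.
split=> [[/H1_eqP [b bP] /H1_eqP [b' bP']]|[[b bP] [b' bP']]].
  split; [exists b => s Gs; rewrite -Cg_prod_row0|exists b' => s Gs]; [exact: bP|exact: bP'].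
congr (_, _); apply/H1_eqP; [exists b|exists b'] => s Gs; last exact: bP'.
by rewrite -bP // -Cg_prod_row0.
Qed.

(** The recursion is solved at each [s] separately. Injectivity ([zLV_eq0]) transfers the cocycle
    identity from the [z n] to the solutions, and [zLV_estimate] transfers continuity. *)
Lemma decomposition_exists (kappa : forall n, H1n n) :
  (forall n, pr (kappa n.+3) = scale a%:P (kappa n.+2) - scale chi%:P (Tr (kappa n.+1))) ->
  exists ks : H1oo * H1oo, forall n,
    (kappa n.+2, - scale chi%:P (Tr (kappa n.+1))) =
      mat_act (Cg_prod p a chi n.+1) (pr_oo n.+2 ks.1, pr_oo n.+2 ks.2).
Proof.
move=> /recursive_cocycles [z [zE zP]].
(* Outside [G] the value is arbitrary, since cochains are only tested on [G]. *)
have /choice [xy xyP] s : exists xy : LVoo p_prime V * LVoo p_prime V,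
    G s -> forall n, zLV (xy.1 n.+1) (xy.2 n.+1) n = z n.+1 s.
  have [Gs|nGs] := pselect (G s); last by exists (0, 0).
  have [x [y E]] := zLV_solve p_odd O_padic chi_unit a_pi (s := fun n => z n s)
    (fun n => zP n s Gs).
  by exists (x, y).
have coc s t : G s -> G t ->
    (xy (Defs.gal_mul s t)).1 = (xy s).1 + LVoo_act act kac s (xy t).1 /\
    (xy (Defs.gal_mul s t)).2 = (xy s).2 + LVoo_act act kac s (xy t).2.
  move=> Gs Gt; have Gst := G_mul Gs Gt.
  have [n|E1 E2] := @zLV_eq0 p p_prime p_odd O pi a chi O_padic r c chi_unit a_pi
    ((xy (Defs.gal_mul s t)).1 - (xy s).1 - LVoo_act act kac s (xy t).1)
    ((xy (Defs.gal_mul s t)).2 - (xy s).2 - LVoo_act act kac s (xy t).2).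
    rewrite !zLVB -zLV_act !xyP //.
    have /asboolP [zM _] := z1P (z n.+1).
    have {}zM : (z n.+1 (Defs.gal_mul s t) : LV _) = (z n.+1 s : LV _) + actn s (z n.+1 t).
      exact: zM.
    by rewrite zM addrAC addrK subrr.
  by split; apply/eqP; rewrite -subr_eq0 opprD addrA ?E1 ?E2.
have cont k s : G s -> exists X : seq algC, forall t, G t -> {in X, s =1 t} ->
    LVoo_nbhs pi k ((xy t).1 - (xy s).1) /\ LVoo_nbhs pi k ((xy t).2 - (xy s).2).
  move=> Gs.
  have /choice [X XP] (n : nat) : exists X : seq algC, forall t, G t -> {in X, s =1 t} ->
      LV_nbhs pi k ((z n.+1 t : LV _) - z n.+1 s).
    by have /asboolP [_ zC] := z1P (z n.+1); exact: zC.
  (* At a level [i <= k] the estimate needs [i + 2 * k < N], so [N = (3 * k).+1] serves all these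
     levels; the list covers the indices up to [N]. *)
  exists (flatten [seq X n | n <- iota 0 (3 * k).+2]) => t Gt st.
  have small n : (n <= (3 * k).+1)%N -> LV_nbhs pi k
      (zLV (((xy t).1 - (xy s).1) n.+1) (((xy t).2 - (xy s).2) n.+1) n).
    move=> nk; rewrite zLVB !xyP //; apply: XP => // x xX; apply: st.
    by apply/flattenP; exists (X n) => //; apply: map_f; rewrite mem_iota; lia.
  have est i : (i <= k)%N -> _ := fun ik => zLV_estimate p_odd O_padic chi_unit a_pi
    (i := i) small (leqnn k) ltac:(lia).
  by split=> i /est [].
have Px : (fun s => (xy s).1) \in @Z1_pred G LVinf.
  apply/asboolP; split=> [s t Gs Gt|k s Gs]; first by case: (coc s t Gs Gt).
  by have [X XP] := cont k s Gs; exists X => t Gt st; case: (XP t Gt st).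
have Py : (fun s => (xy s).2) \in @Z1_pred G LVinf.
  apply/asboolP; split=> [s t Gs Gt|k s Gs]; first by case: (coc s t Gs Gt).
  by have [X XP] := cont k s Gs; exists X => t Gt st; case: (XP t Gt st).
exists (H1_class (MkZ1 Px), H1_class (MkZ1 Py)) => n; apply/esym.
rewrite -!zE Tr_class scale_class -H1_classN.
have act0 : forall m s, actn s 0 - 0 = 0 :> LV m.
  by move=> m s; rewrite subr0; apply/ffunP=> u; rewrite !ffunE linear0.
apply/mat_act_class; split; exists 0 => s Gs; rewrite act0 /=.
  by rewrite xyP // subrr.
(* On level [n.+2], Phi_{n+1} is Tr after pr; pr brings z_n down to level [n.+1], where it equals
   [z n.+1 s]. *)
rewrite Cg_prod_row1 Cg_prod_row0 -LV_tr_pr // zLV_pr // !lv_compat xyP //.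
change (- (chi *: LV_tr (z n.+1 s)) - - LV_scale chi%:P (LV_tr (z n.+1 s)) = 0).
by rewrite LV_scaleC opprK addNr.
Qed.

(** The matrix identities start at level 2, so level 1 is seen only through Tr. As [LV_tr (x s)] is
    fixed by the shift, [LV_shift b - b] is invariant under [G], hence zero, and the constant [b]
    comes from level 1. *)
Lemma LV_tr_act_descend (x : GQ -> LV 1) (b : LV 2) :
  (forall s, G s -> LV_tr (x s) = actn s b - b) ->
  exists b' : LV 1, forall s, G s -> x s = actn s b' - b'.
Proof.
move=> xb.
have tr_shift (f : LV 1) : LV_shift (LV_tr f) = LV_tr f.
  apply/ffunP=> u; rewrite !ffunE; congr (f _).
  by apply: u_val_inj => //; rewrite !u_red_val // !expn1 (eqP (u_valP _)) (eqP (u_valP _)).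
have b_shift : LV_shift b = b.
  apply/eqP; rewrite -subr_eq0; apply/eqP/H0_trivial => s Gs.
  rewrite LV_actB -LV_shift_act.
  have -> : actn s b = LV_tr (x s) + b by rewrite xb // subrK.
  have -> : LV_shift (LV_tr (x s) + b) = LV_tr (x s) + LV_shift b.
    by rewrite -{2}(tr_shift (x s)); apply/ffunP=> u; rewrite !ffunE.
  by rewrite opprD addrACA subrr add0r.
have b_const u : b u = b 1%g.
  have [i _ ->] := u_gen_expgP p_odd u.
  have Ei : iter i (@LV_shift p p_prime O V 2) b = b by elim: i => //= i ->.
  by rewrite -{1}Ei iter_LV_shift mulVg.
exists [ffun=> b 1%g] => s Gs; apply/ffunP=> u.
have [v <-] : exists v, u_red v = u.
  exists 1%g; apply: u_val_inj => //.
  by rewrite u_red_val // !expn1 (eqP (u_valP _)) -(eqP (u_valP u)) modn_small ?u_val_lt.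
have /ffunP/(_ v) := xb s Gs; rewrite !ffunE => ->.
by rewrite (b_const v) (b_const (_ * v)%g).
Qed.

Lemma decomposition_unique (kappa : forall n, H1n n) (ks ks' : H1oo * H1oo) :
  (forall n, (kappa n.+2, - scale chi%:P (Tr (kappa n.+1))) =
     mat_act (Cg_prod p a chi n.+1) (pr_oo n.+2 ks.1, pr_oo n.+2 ks.2)) ->
  (forall n, (kappa n.+2, - scale chi%:P (Tr (kappa n.+1))) =
     mat_act (Cg_prod p a chi n.+1) (pr_oo n.+2 ks'.1, pr_oo n.+2 ks'.2)) ->
  ks = ks'.
Proof.
case: ks ks' => [k1 k2] [k1' k2'] /= ksP ksP'.
have [x Ex] := H1_class_surj k1; have [y Ey] := H1_class_surj k2.
have [x' Ex'] := H1_class_surj k1'; have [y' Ey'] := H1_class_surj k2'.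
have [z zE] : exists z : forall n, Z1 G (LVn n), forall n, H1_class (z n) = kappa n.
  by exists (fun n => H1_repr (kappa n)) => n; exact: H1_reprK.
have ksE n : (kappa n.+2, - scale chi%:P (Tr (kappa n.+1))) =
    (H1_class (z n.+2), H1_class (- Z1_map (LV_scale_hom pi act kac n.+2 chi%:P)
        (Z1_map (LV_tr_hom pi act kac n.+1) (z n.+1)))).
  by rewrite H1_classN -scale_class -Tr_class !zE.
rewrite -Ex -Ey in ksP; rewrite -Ex' -Ey' in ksP'.
have rep n := (mat_act_class n.+1 x y (z n.+2) _).1 (etrans (esym (ksP n)) (ksE n)).
have rep' n := (mat_act_class n.+1 x' y' (z n.+2) _).1 (etrans (esym (ksP' n)) (ksE n)).
pose dx s := x s - x' s : LVoo p_prime V; pose dy s := y s - y' s : LVoo p_prime V.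
have subact m s (b b' : LV m) : actn s b - b - (actn s b' - b') = actn s (b - b') - (b - b').
  by rewrite LV_actB subrBAC.
have top n : exists b : LV n.+2, forall s, G s ->
    zLV (dx s n.+2) (dy s n.+2) n.+1 = actn s b - b.
  have [[b bP] _] := rep n; have [[b' bP'] _] := rep' n.
  exists (b - b') => s Gs; rewrite -subact -bP // -bP' // zLVB.
  by rewrite opprB addrA subrK.
(* The second row at level 2 is [- chi] times the trace of the first coordinate, whence the factor
   [- chi^-1]. *)
have bottom : exists b : LV 1, forall s, G s -> dx s 1 = actn s b - b.
  have [_ [b bP]] := rep 0%N; have [_ [b' bP']] := rep' 0%N.
  apply: (@LV_tr_act_descend _ (- chi^-1 *: (b - b'))) => s Gs.
  have := subact _ s b b'; rewrite -bP // -bP' //.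
  rewrite opprB addrA subrK !Cg_prod_row1 !Cg_prod_row0 !zLV0 -!LV_tr_pr // !lv_compat.
  rewrite opprK addrC -scalerBr -LV_trB.
  have -> : x' s 1 - x s 1 = - dx s 1 by rewrite opprB.
  move=> E; have -> : actn s (- chi^-1 *: (b - b')) = - chi^-1 *: actn s (b - b').
    by apply/ffunP=> u; rewrite !ffunE linearZ.
  rewrite -scalerBr -E scaleNr scalerA mulVr // scale1r.
  by apply/ffunP=> u; rewrite !ffunE opprK.
have b_ex n : exists b : LV n.+1, forall s, G s ->
    zLV (dx s n.+1) (dy s n.+1) n = actn s b - b by case: n.
pose b n : LV n := if n is m.+1 return LV n then sval (cid (b_ex m)) else 0.
have bP n s : G s -> zLV (dx s n.+1) (dy s n.+1) n = actn s (b n.+1) - b n.+1.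
  exact: svalP (cid (b_ex n)) s.
(* By the recursion for [zLV], both sides have the same coboundary, so their difference is invariant
   and thus zero. *)
have b_rec n : LV_pr (b n.+3) = a *: b n.+2 - chi *: LV_tr (b n.+1).
  apply/eqP; rewrite -subr_eq0; apply/eqP/H0_trivial => s Gs; apply/eqP.
  rewrite -subr_eq0.
  have E3 := congr1 (@LV_pr p p_prime O V n.+2) (bP n.+2 s Gs).
  have E2 := bP n.+1 s Gs; have E1 := congr1 (@LV_tr p p_prime O V n.+1) (bP n s Gs).
  rewrite zLV_pr // !lv_compat LV_prB LV_pr_act in E3.
  rewrite -[X in LV_tr (zLV X _ _)](lv_compat (dx s)) -[X in LV_tr (zLV _ X _)](lv_compat (dy s)) in E1.
  rewrite -zLV_pr // LV_tr_pr // LV_trB LV_tr_act in E1.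
  rewrite zLVSS E2 E1 in E3.
  have actZ d f : actn s (d *: f) = d *: actn s f :> LV n.+2.
    by apply/ffunP=> u; rewrite !ffunE linearZ.
  rewrite !LV_actB !actZ; apply/eqP; move: E3; rewrite !scalerBr.
  move: (LV_pr _) (actn s (LV_pr _)) (a *: actn s _) (a *: b _) (chi *: actn s _) (chi *: LV_tr _).
  move=> u2 u1 u3 u4 u5 u6 E.
  rewrite [LHS]subrBAC [u3 - u5 - _]subrBAC E; exact: subrr.
(* Solving the recursion with data [b] gives elements at infinite level; by injectivity their
   coboundaries are [dx] and [dy]. *)
have [bx [by_ bxyP]] := zLV_solve p_odd O_padic chi_unit a_pi b_rec.
have dE s : G s -> dx s = LVoo_act act kac s bx - bx /\ dy s = LVoo_act act kac s by_ - by_.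
  move=> Gs; have [n|E1 E2] := @zLV_eq0 p p_prime p_odd O pi a chi O_padic r c chi_unit a_pi
    (dx s - (LVoo_act act kac s bx - bx)) (dy s - (LVoo_act act kac s by_ - by_)).
    rewrite zLVB bP //; change (actn s (b n.+1) - b n.+1 -
      zLV (actn s (bx n.+1) - bx n.+1) (actn s (by_ n.+1) - by_ n.+1) n = 0).
    by rewrite zLVB -zLV_act bxyP subrr.
  by split; apply/eqP; rewrite -subr_eq0 ?E1 ?E2.
rewrite -Ex -Ey -Ex' -Ey'; congr (_, _); apply/H1_eqP.
  by exists bx => s Gs; case: (dE s Gs).
by exists by_ => s Gs; case: (dE s Gs).
Qed.

End Decomposition.

(** * Invariants under p-groups *)

Definition gal_pow (s : GQ) (m : nat) : GQ := iter m (Defs.gal_mul s) Defs.gal_one.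

Lemma GQ_ext (s t : GQ) : s =1 t -> s = t.
Proof.
case: s => f cf; case: t => g cg /= fg.
have {}fg : f = g by apply/funext.
move: cg; rewrite -fg => cg; congr GRing.RMorphism.Pack.
case: cf => [[cf1] [cf2]]; case: cg => [[cg1] [cg2]].
by congr GRing.RMorphism.Class; congr (_ _); apply: Prop_irrelevance.
Qed.

Lemma gal_powE s m x : gal_pow s m x = iter m s x.
Proof. by elim: m => //= m <-. Qed.

Section GaloisExtension.
Variables (K F : set algC) (n : nat).

(** Cayley and Lagrange: left multiplication on the [n] automorphisms [g i] gives a permutation
    group of order [n]. The automorphism is recovered by evaluating at the index [i0] of the
    identity. *)
Lemma galois_pow s : galois_ext K F n -> fixer K s ->
  forall x, F x -> gal_pow s n x = x.
Proof.
move=> [_ _ F_stable [g [gK g_inj g_surj]]] Ks.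
have fixer_mul t u : fixer K t -> fixer K u -> fixer K (Defs.gal_mul t u).
  by move=> Kt Ku x Kx; rewrite /= Ku // Kt.
have /choice [h hP] (t : GQ) : exists f : 'I_n -> 'I_n, fixer K t ->
    forall l x, F x -> t (g l x) = g (f l) x.
  have [Kt|nKt] := pselect (fixer K t); last by exists id.
  have /choice [f fP] l : exists j, forall x, F x -> t (g l x) = g j x.
    exact: g_surj _ (fixer_mul _ _ Kt (gK l)).
  by exists f.
have h_inj t : fixer K t -> injective (h t).
  move=> Kt l l' E; apply: g_inj => x Fx; apply: (fmorph_inj t).
  by rewrite !hP // E.
pose rho i := perm (h_inj (g i) (gK i)).
have [i0 i0P] := g_surj Defs.gal_one (fun x _ => erefl).
have rhoP i t : fixer K t -> (forall x, F x -> t x = g i x) ->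
    forall l, rho i l = h t l.
  move=> Kt ti l; rewrite permE; apply: g_inj => x Fx.
  by rewrite -!hP // ti //; apply: F_stable.
have rho_inj : injective rho.
  move=> i j /permP/(_ i0); rewrite !permE => E; apply: g_inj => x Fx.
  by have := hP _ (gK i) i0 x Fx; rewrite E -hP // -i0P.
pose A := [set rho i | i in 'I_n]%SET.
have A_group : group_set A.
  apply/group_setP; split=> [|s1 s2 /imsetP [i _ ->] /imsetP [j _ ->]].
    apply/imsetP; exists i0 => //; apply/permP=> l; rewrite perm1.
    by rewrite (rhoP _ Defs.gal_one) //; apply: g_inj => x Fx; rewrite -hP.
  have Kji := fixer_mul _ _ (gK j) (gK i).
  have [k kP] := g_surj _ Kji.
  apply/imsetP; exists k => //; apply/permP=> l; rewrite permM [RHS](rhoP _ _ Kji) //.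
  by apply: g_inj => x Fx; rewrite !permE -(hP _ Kji) // -!hP.
have [i iP] := g_surj s Ks.
have rho_n : (rho i ^+ n = 1)%g.
  have cardA : #|A| = n by rewrite card_imset // card_ord.
  have : (rho i ^+ #|Group A_group| = 1)%g by apply: expg_cardG; apply: imset_f.
  by rewrite /= cardA.
have iterP m : forall x, F x -> g ((rho i ^+ m)%g i0) x = gal_pow s m x.
  elim: m => [|m IH] x Fx; first by rewrite expg0 perm1 -i0P.
  by rewrite expgSr permM (rhoP i s) // -hP // IH.
by move=> x Fx; rewrite -iterP // rho_n perm1 -i0P.
Qed.

End GaloisExtension.

Section ResidualFixedPoints.
Variables (p : nat) (p_prime : prime p) (O : idomainType) (pi : O).
Variables (V : lmodType O) (act : GQ -> {linear V -> V}) (H G : set GQ).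
Hypotheses (p_pi : exists b, p%:R = pi * b)
  (V_fin : exists vs : seq V, forall v, exists2 w, w \in vs & adic pi 1 (v - w))
  (H_one : H Defs.gal_one) (H_mul : forall s t, H s -> H t -> H (Defs.gal_mul s t))
  (act_one : forall v, act Defs.gal_one v = v)
  (act_mul : forall s t v, H s -> H t -> act (Defs.gal_mul s t) v = act s (act t v))
  (G_normal : forall s t, H s -> G t ->
     exists2 t', G t' & forall v, act t (act s v) = act s (act t' v))
  (G_pow : forall s, H s -> exists k, G (gal_pow s (p ^ k))).

Local Notation res0 := (adic pi (V := V) 1).

(* The finite p-group through which [H] acts on the [G]-invariants of V / pi V
   fixes a nonzero vector if there are nonzero invariants. *)
Lemma residual_H0_pgroup :
  residual_H0_trivial pi H act -> residual_H0_trivial pi G act.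
Proof.
move=> H0 v0 v0G; apply: contrapT => v0_neq0.
have [vs vsP] := V_fin.
have resN v : res0 v -> res0 (- v) by move=> [w ->]; exists (- w); rewrite scalerN.
have res_act s v : res0 v -> res0 (act s v) by move=> [w ->]; exists (act s w); rewrite linearZ.
(* V / pi V is modelled by positions in the list [vs]: [cls v] is the first position whose entry is
   congruent to [v], and [rep] returns the entry. *)
pose test (v : V) := [pred w | `[< res0 (v - w) >]].
have has_test (v : V) : has (test v) vs.
  by have [w ws vw] := vsP v; apply/hasP; exists w => //; apply/asboolP.
have cls_lt (v : V) : (find (test v) vs < size vs)%N by rewrite -has_find.
pose cls (v : V) := Ordinal (cls_lt v); pose rep (i : 'I_(size vs)) := nth 0 vs i.
have repP v : res0 (v - rep (cls v)) by have := nth_find 0 (has_test v) => /asboolP.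
have cls_eq v w : res0 (v - w) -> cls v = cls w.
  move=> vw; apply: val_inj; apply: eq_find => u; apply/asboolP/asboolP => E.
    have -> : w - u = (v - u) - (v - w) by rewrite opprB [RHS]addrC addrA subrK.
    exact: adicB.
  have -> : v - u = (v - w) + (w - u) by rewrite addrA subrK.
  exact: adicD.
have cls_inj v w : cls v = cls w -> res0 (v - w).
  move=> E; have -> : v - w = (v - rep (cls v)) - (w - rep (cls w)).
    by rewrite E opprB addrA subrK.
  exact: adicB.
pose inv v := forall t, G t -> res0 (act t v - v).
have inv_congr v w : res0 (v - w) -> inv v -> inv w.
  move=> vw vinv t Gt.
  have -> : act t w - w = (act t v - v) - (act t (v - w) - (v - w)).
    have -> : act t (v - w) - (v - w) = (act t v - v) - (act t w - w).
      by rewrite linearB; apply: subrBAC.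
    by rewrite opprB [RHS]addrC subrK.
  by apply: adicB; [exact: vinv|apply: adicB => //; apply: res_act].
pose W : {set 'I_(size vs)} := [set i | (cls (rep i) == i) && `[< inv (rep i) >]]%SET.
have clsW v : inv v -> cls v \in W.
  move=> vinv; rewrite inE; apply/andP; split.
    by apply/eqP/esym/cls_eq/repP.
  by apply/asboolP/(inv_congr v) => //; apply: repP.
have Wcls i : i \in W -> cls (rep i) = i by rewrite inE => /andP [/eqP].
have Winv i : i \in W -> inv (rep i) by rewrite inE => /andP [_ /asboolP].
(* The identity outside [W] turns the induced maps into permutations of all positions. *)
pose ext (f : V -> V) i := if i \in W then cls (f (rep i)) else i.
have ext_inj (f : V -> V) k : (forall v, inv v -> inv (f v)) ->
    (forall v w, res0 (v - w) -> res0 (f v - f w)) ->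
    (forall v, inv v -> res0 (iter (p ^ k) f v - v)) ->
    [/\ forall i, i \in W -> ext f i \in W,
        forall i, iter (p ^ k) (ext f) i = i & injective (ext f)].
  move=> f_inv f_res f_pow.
  have stab i : i \in W -> ext f i \in W.
    by move=> iW; rewrite /ext iW; apply/clsW/f_inv/Winv.
  have stab_iter i m : i \in W -> iter m (ext f) i \in W.
    by move=> iW; elim: m => //= m IH; apply: stab.
  have iterE i m : i \in W -> iter m (ext f) i = cls (iter m f (rep i)).
    move=> iW; elim: m => [|m IH] /=; first by rewrite Wcls.
    rewrite {1}/ext stab_iter // IH; apply: cls_eq.
    by apply: f_res; rewrite -opprB; apply: resN; apply: repP.
  have pow i : iter (p ^ k) (ext f) i = i.
    have [iW|niW] := boolP (i \in W).
      by rewrite iterE // -[RHS]Wcls //; apply/cls_eq/f_pow/Winv.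
    by elim: (p ^ k)%N => //= m ->; rewrite /ext (negPf niW).
  split=> // i j E; rewrite -(pow i) -(pow j).
  have : (0 < p ^ k)%N by rewrite expn_gt0 prime_gt0.
  by case: (p ^ k)%N => // m _; rewrite !iterSr E.
have actP s : H s -> exists k, [/\ forall i, i \in W -> ext (act s) i \in W,
        forall i, iter (p ^ k) (ext (act s)) i = i & injective (ext (act s))].
  move=> Hs; have [k Gk] := G_pow Hs; exists k; apply: ext_inj.
  - move=> v vinv t Gt; have [t' Gt' ->] := G_normal Hs Gt.
    by rewrite -linearB; apply: res_act; apply: vinv.
  - by move=> v w vw; rewrite -linearB; apply: res_act.
  - move=> v vinv; have -> : iter (p ^ k) (act s) v = act (gal_pow s (p ^ k)) v.
      suff [_ ->] : H (gal_pow s (p ^ k)) /\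
        act (gal_pow s (p ^ k)) v = iter (p ^ k) (act s) v by [].
      elim: (p ^ k)%N => [|m [Hm IH]]; first by rewrite act_one.
      by split; [apply: H_mul|rewrite /= act_mul // IH].
    exact: vinv.
(* The image of [H]; its elements have p-power order, so it is a p-group by Cauchy's theorem. *)
pose P := [set s : {perm 'I_(size vs)} | `[< exists2 t, H t & s =1 ext (act t) >]]%SET.
have inP (s : {perm 'I_(size vs)}) : s \in P <-> exists2 t, H t & s =1 ext (act t).
  by rewrite inE; split=> /asboolP.
have P_group : group_set P.
  apply/group_setP; split=> [|s1 s2].
    apply/inP; exists Defs.gal_one => // i; rewrite perm1 /ext.
    by case: ifP => // iW; rewrite act_one Wcls.
  move=> /inP [t1 Ht1 E1] /inP [t2 Ht2 E2]; apply/inP.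
  exists (Defs.gal_mul t2 t1); first exact: H_mul.
  move=> i; rewrite permM E1 E2.
  have [iW|niW] := boolP (i \in W); last by rewrite /ext !(negPf niW).
  have [k [stab _ _]] := actP _ Ht1; have := stab i iW.
  have -> : ext (act t1) i = cls (act t1 (rep i)) by rewrite /ext iW.
  move=> sW; rewrite /ext sW iW.
  apply: cls_eq; rewrite act_mul // -linearB; apply: res_act.
  by rewrite -opprB; apply: resN; apply: repP.
have P_acts : [acts P, on W | 'P].
  apply/actsP => s /inP [t Ht E] i; rewrite /= apermE E.
  have [k [stab _ _]] := actP _ Ht.
  have [iW|niW] := boolP (i \in W); first by rewrite stab.
  by rewrite /ext (negPf niW); apply/negbTE.
have P_pgroup : (p.-group (Group P_group))%g.
  apply/pgroupP => q q_prime /(Cauchy q_prime) [s /inP [t Ht E] ord_s].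
  have [k [_ pow _]] := actP _ Ht.
  have : (#[s]%g %| p ^ k)%N.
    rewrite order_dvdn; apply/eqP/permP => i; rewrite permX perm1 -[RHS]pow.
    exact: eq_iter.
  rewrite ord_s Euclid_dvdX // => /andP [+ _]; rewrite dvdn_prime2 // => /eqP ->.
(* Translation by [v0] preserves [W], has p-power order and, as [v0] is nonzero modulo pi, fixes no
   point of [W]; hence p divides the cardinality of [W]. *)
have [k [tr_stab tr_pow tr_inj]] : exists k,
    [/\ forall i, i \in W -> ext (+%R v0) i \in W,
        forall i, iter (p ^ k) (ext (+%R v0)) i = i & injective (ext (+%R v0))].
  exists 1%N; apply: ext_inj.
  - move=> v vinv t Gt; rewrite linearD opprD addrACA.
    by apply: adicD; [exact: v0G|exact: vinv].
  - by move=> v w; rewrite opprD addrACA subrr add0r.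
  - move=> v _; rewrite expn1.
    have -> : iter p (+%R v0) v = v0 *+ p + v.
      by elim: (p) => [|m /= ->]; rewrite ?mulr0n ?add0r // mulrS addrA.
    rewrite addrK -scaler_nat; have [b ->] := p_pi.
    by exists (b *: v0); rewrite scalerA expr1.
pose tau := perm tr_inj.
have tau_pgroup : (p.-group <[tau]>)%g.
  rewrite /pgroup -orderE; apply: (@pnat_dvd _ (p ^ k)%N); last first.
    by rewrite pnatX pnat_id.
  rewrite order_dvdn; apply/eqP/permP => i; rewrite permX perm1 -[RHS]tr_pow.
  by apply: eq_iter => j; rewrite permE.
have tau_acts : [acts <[tau]>%g, on W | 'P].
  rewrite cycle_subG; apply/astabsP => i; rewrite /= apermE permE.
  have [iW|niW] := boolP (i \in W); first exact: tr_stab.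
  by rewrite /ext (negPf niW) (negPf niW).
have W_mod : #|W| = 0 %[mod p].
  rewrite (pgroup_fix_mod tau_pgroup tau_acts).
  suff -> : 'Fix_(W | 'P)(<[tau]>)%g = finset.set0 by rewrite cards0.
  apply/setP => i; rewrite finset.in_set0; apply/negP => /setIP [iW].
  move/afixP/(_ tau (cycle_id _)) => /=; rewrite apermE permE /ext iW => E.
  apply: v0_neq0; have := cls_inj _ _ (etrans E (esym (Wcls _ iW))).
  by rewrite addrK.
(* So p divides the number of fixed points of [P] on [W]. The class of 0 is one of them, hence a
   nonzero class is fixed too, contradicting [H0]. *)
have := pgroup_fix_mod P_pgroup P_acts; rewrite W_mod mod0n => /esym/eqP.
have inv0 : inv 0 by move=> t _; rewrite linear0 subrr; apply: adic0.
have fix0 : cls 0 \in ('Fix_(W | 'P)(P))%g.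
  apply/setIP; split; first exact: clsW.
  apply/afixP => s /inP [t Ht E]; rewrite /= apermE E /ext clsW //.
  apply: cls_eq; rewrite subr0; apply: res_act.
  by rewrite -[rep _]opprK; apply: resN; rewrite -[- _]add0r; apply: repP.
rewrite (cardsD1 (cls 0)) fix0 => p_dvd_fix.
have : (0 < #|('Fix_(W | 'P)(Group P_group))%g :\ cls 0%R|)%N.
  rewrite lt0n; apply/eqP => E; move: p_dvd_fix; rewrite E addn0 -/(dvdn p 1) dvdn1 => /eqP p1.
  by move: (prime_gt1 p_prime); rewrite p1.
case/card_gt0P => i /setD1P [i_neq0 /setIP [iW /afixP iP]].
case/eqP: i_neq0; rewrite -(Wcls i iW); apply: cls_eq; rewrite subr0.
apply: H0 => s Hs; have [k' [_ _ s_inj]] := actP s Hs.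
have : perm s_inj \in P.
  by apply/inP; exists s => // j; rewrite permE.
move/iP; rewrite /= apermE permE /ext iW => E.
exact: cls_inj (etrans E (esym (Wcls _ iW))).
Qed.

End ResidualFixedPoints.

(** * The Galois module M *)

Section InvariantsOfLevels.
Variables (p : nat) (p_prime : prime p) (p_odd : odd p) (O : idomainType) (pi : O).
Variables (O_padic : padic_integers p pi) (r c : nat).
Local Notation V := 'M[O]_(r, c).
Variables (act : GQ -> {linear V -> V}) (kac : GQ -> oneZp p_prime).
Variables (K F : set algC) (e : nat).
Hypotheses (F_galois : galois_ext K F (p ^ e))
  (act_one : forall v, act Defs.gal_one v = v)
  (act_mul : forall s t v, fixer K s -> fixer K t ->
     act (Defs.gal_mul s t) v = act s (act t v))
  (kac_mul : forall n s t, fixer K s -> fixer K t ->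
     kac (Defs.gal_mul s t) n = (kac s n * kac t n)%g)
  (H0_residual : residual_H0_trivial pi (fixer K) act).

Definition gal_inv (s : GQ) : GQ := algC_invaut s.

Lemma gal_invK s : Defs.gal_mul (gal_inv s) s = Defs.gal_one.
Proof. by apply: GQ_ext => x /=; apply: algC_autK. Qed.

Lemma fixer_mul (L : set algC) s t : fixer L s -> fixer L t -> fixer L (Defs.gal_mul s t).
Proof. by move=> Ls Lt x Lx; rewrite /= Lt // Ls. Qed.

Lemma fixer_inv (L : set algC) s : fixer L s -> fixer L (gal_inv s).
Proof. by move=> Ls x Lx; rewrite -{1}(Ls x Lx); apply: algC_autK. Qed.

Lemma mx_residue_finite : exists vs : seq V, forall v,
  exists2 w, w \in vs & adic pi 1 (v - w).
Proof.
have [R RP] := finite_residue_field O_padic.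
exists [seq \matrix_(i, j) R`_(h (i, j)) | h : {ffun 'I_r * 'I_c -> 'I_(size R)}
          <- enum {ffun 'I_r * 'I_c -> 'I_(size R)}] => v.
have /choice [h hP] (ij : 'I_r * 'I_c) : exists l : 'I_(size R),
    adic pi (V := O^o) 1 (v ij.1 ij.2 - R`_l).
  have [y yR vy] := RP (v ij.1 ij.2); have y_lt : (index y R < size R)%N by rewrite index_mem.
  by exists (Ordinal y_lt); rewrite /= nth_index.
exists (\matrix_(i, j) R`_(h (i, j))).
  apply/mapP; exists [ffun ij => h ij]; first by rewrite mem_enum.
  by apply/matrixP=> i j; rewrite !mxE ffunE.
by apply/adic_mxP => i j; rewrite !mxE; apply: (hP (i, j)).
Qed.

(** On this subgroup the action on [LV n] is coefficientwise. *)
Let G n : set GQ := [set s | fixer F s /\ kac s n = 1%g].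

Lemma kac_one n : kac Defs.gal_one n = 1%g.
Proof.
have K1 : fixer K Defs.gal_one by [].
apply: (mulgI (kac Defs.gal_one n)); rewrite mulg1 -kac_mul //.
by congr (kac _ n); apply: GQ_ext.
Qed.

Lemma kac_pow n s m : fixer K s -> kac (gal_pow s m) n = (kac s n ^+ m)%g.
Proof.
move=> Ks; suff [_ ->] : fixer K (gal_pow s m) /\
  kac (gal_pow s m) n = (kac s n ^+ m)%g by [].
elim: m => [|m [Km IH]]; first by rewrite expg0 kac_one.
by split; [exact: fixer_mul|rewrite /= kac_mul // IH expgS].
Qed.

(** [G n] is normal in the fixer of [K] and contains all [p ^ (e + n.-1)]-th powers: [p ^ e] is the
    degree of F/K and [p ^ n.-1] kills [U n]. *)
Lemma residual_H0_levels n : residual_H0_trivial pi (G n) act.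
Proof.
have [_ KF F_stable _] := F_galois.
apply: (@residual_H0_pgroup p p_prime O pi V act (fixer K)) => //.
- exact: p_dvd O_padic.
- exact: mx_residue_finite.
- exact: fixer_mul.
- move=> s t Ks [Ft kt]; have Kt : fixer K t by move=> x /KF /Ft.
  have Ki := fixer_inv Ks; have Kts := fixer_mul Kt Ks.
  exists (Defs.gal_mul (gal_inv s) (Defs.gal_mul t s)).
    split; first by move=> x Fx; rewrite /= Ft ?algC_autK //; apply: F_stable.
    by rewrite !kac_mul // kt mul1g -kac_mul // gal_invK kac_one.
  move=> v; rewrite -!act_mul //; last exact: fixer_mul.
  congr (act _ v); apply: GQ_ext => x /=; exact/esym/algC_invautK.
- move=> s Ks; exists (e + n.-1)%N; split.
    move=> x Fx; rewrite gal_powE expnD mulnC iterM.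
    elim: (p ^ n.-1)%N => //= m ->; rewrite -gal_powE.
    exact: galois_pow F_galois Ks x Fx.
  by rewrite kac_pow // expnD mulnC expgM u_expgX // expg1n.
Qed.

(** The coefficients of an invariant [f] are [G n]-invariant, hence divisible by pi, and the
    quotient is again invariant. Iterating, [f] is divisible by every pi^k. *)
Lemma LV_H0_trivial n (f : LV p_prime V n) :
  (forall s, fixer F s -> LV_act act kac s f = f) -> f = 0.
Proof.
move=> f_inv.
suff div k : exists g : LV p_prime V n, f = pi ^+ k *: g /\
    forall s, fixer F s -> LV_act act kac s g = g.
  apply/ffunP=> u; rewrite [RHS]ffunE; apply: (mx_separated O_padic) => k.
  by have [g [-> _]] := div k; exists (g u); rewrite ffunE.
elim: k => [|k [g [Ef g_inv]]]; first by exists f; rewrite expr0 scale1r.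
have /choice [h hP] (u : U p_prime n) : adic pi 1 (g u).
  apply: (residual_H0_levels (n := n)) => s [Fs ks].
  have /ffunP/(_ u) := g_inv s Fs; rewrite ffunE ks mul1g => ->.
  by rewrite subrr; apply: adic0.
have Eg : g = pi *: [ffun u => h u] by apply/ffunP=> u; rewrite !ffunE hP expr1.
exists [ffun u => h u]; split=> [|s Fs]; first by rewrite Ef Eg scalerA exprSr.
have := g_inv s Fs; rewrite Eg => E; apply/ffunP=> u.
have /ffunP/(_ u) := E; rewrite !ffunE linearZ /= => /matrixP Eu.
apply/matrixP=> i j; have := Eu i j; rewrite !mxE; apply: mulfI.
exact: pi_neq0 O_padic.
Qed.

End InvariantsOfLevels.

(** * Multiplicativity and continuity of the action on M *)

Section GaloisModule.
Variables (p d : nat) (p_prime : prime p) (O : idomainType) (pi : O).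
Hypothesis (O_padic : padic_integers p pi).

Lemma adic_p n (x : O) : adic (p%:R : O) (V := O^o) n x -> adic pi (V := O^o) n x.
Proof.
have [b Eb] := p_dvd O_padic; move=> [y ->]; exists (b ^+ n * y).
by rewrite Eb exprMn; apply: esym; apply: mulrA.
Qed.

Lemma adic_nat_mod n k l : k = l %[mod p ^ n] ->
  adic pi (V := O^o) n (k%:R - l%:R).
Proof.
move=> kl; apply: adic_p; exists ((k %/ p ^ n)%:R - (l %/ p ^ n)%:R).
rewrite {1}(divn_eq k (p ^ n)) {1}(divn_eq l (p ^ n)) kl !natrD !natrM natrX.
by rewrite opprD addrACA subrr addr0 -mulrBl mulrC.
Qed.

Lemma adicM n (x y x' y' : O) : adic pi (V := O^o) n (x - x') ->
  adic pi (V := O^o) n (y - y') -> adic pi (V := O^o) n (x * y - x' * y').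
Proof.
move=> [u Eu] [v Ev]; exists (u * y + x' * v).
have -> : x * y - x' * y' = (x - x') * y + x' * (y - y') by ring.
rewrite Eu Ev; change (pi ^+ n * u * y + x' * (pi ^+ n * v) = pi ^+ n * (u * y + x' * v)).
by ring.
Qed.

Lemma adicC n (x y : O) : adic pi (V := O^o) n (x - y) -> adic pi (V := O^o) n (y - x).
Proof. by move=> [u E]; exists (- u); rewrite scalerN -E opprB. Qed.

Lemma adic_trans n (x y z : O) : adic pi (V := O^o) n (x - y) ->
  adic pi (V := O^o) n (y - z) -> adic pi (V := O^o) n (x - z).
Proof. by move=> xy yz; have := adicD xy yz; rewrite addrA subrK. Qed.

Section Cyclotomic.
Variables (cyc : GQ -> O) (cycP : is_cyclotomic p cyc).

(** Modulo pi^n, [cyc] is read off from one primitive root; its properties below are checked in this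
    way for each [n]. *)
Lemma cyclotomic_root n : exists z : algC, (p ^ n).-primitive_root z /\
  forall s : GQ, exists2 k, s z = z ^+ k & adic pi (V := O^o) n (cyc s - k%:R).
Proof.
have [|z z_prim] := @C_prim_root_exists (p ^ n)%N; first by rewrite expn_gt0 prime_gt0.
exists z; split=> // s; have [k [Ek ck]] := cycP s (prim_expr_order z_prim).
by exists k => //; apply: adic_p.
Qed.

Lemma cyclotomic_mul s t : cyc (Defs.gal_mul s t) = cyc s * cyc t.
Proof.
apply/eqP; rewrite -subr_eq0; apply/eqP/(adic_separated O_padic) => n.
have [z [z_prim zP]] := cyclotomic_root n.
have [i Ei ci] := zP s; have [j Ej cj] := zP t; have [k Ek ck] := zP (Defs.gal_mul s t).
apply: (adic_trans ck); apply/adicC; apply: (adic_trans (adicM ci cj)).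
rewrite -natrM; apply: adic_nat_mod; apply/eqP.
by rewrite -(eq_prim_root_expr z_prim) -Ek /= Ej rmorphXn /= Ei exprM.
Qed.

Lemma cyclotomic_one : cyc Defs.gal_one = 1.
Proof.
apply/eqP; rewrite -subr_eq0; apply/eqP/(adic_separated O_padic) => n.
have [z [z_prim zP]] := cyclotomic_root n; have [k Ek ck] := zP Defs.gal_one.
apply: (adic_trans ck); apply: (@adic_nat_mod n k 1); apply/eqP.
by rewrite -(eq_prim_root_expr z_prim) -Ek expr1.
Qed.

Lemma cyclotomic_continuous n (s : GQ) : exists X : seq algC, forall t : GQ,
  {in X, s =1 t} -> adic pi (V := O^o) n (cyc t - cyc s).
Proof.
have [z [z_prim zP]] := cyclotomic_root n; exists [:: z] => t st.
have [i Ei ci] := zP s; have [j Ej cj] := zP t.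
apply: (adic_trans cj); apply/adicC/(adic_trans ci); apply: adic_nat_mod; apply/eqP.
by rewrite -(eq_prim_root_expr z_prim) -Ei -Ej st // mem_head.
Qed.

End Cyclotomic.

(** Conjugation sends the square root of -d to itself or its negative. This stability gives
    [GK_conj], by which [twist_conj] evaluates [phi] inside G_K. *)
Lemma QK_conj x : QK d x -> QK d x^*.
Proof.
move=> [a [b ->]].
have conj_rat (q : rat) : (ratr q : algC)^* = ratr q := fmorph_rat (@Num.conj algC) q.
rewrite rmorphD /= conj_rat [X in _ + X]rmorphM /= conj_rat.
have /eqP : (sqrtC (- d%:R : algC))^* ^+ 2 = sqrtC (- d%:R) ^+ 2.
  by rewrite -rmorphXn /= sqrtCK rmorphN rmorph_nat.
rewrite eqf_sqr => /orP [/eqP ->|/eqP ->]; first by exists a, b.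
by exists a, (- b); rewrite rmorphN mulrN mulNr.
Qed.

Lemma GK_conj s : GK d s ->
  GK d (Defs.gal_mul complex_conj (Defs.gal_mul s complex_conj)).
Proof.
by move=> Ks x Kx; rewrite /= Ks ?conjCK //; apply: QK_conj.
Qed.

Section TensorModule.
Variables (e : algC -> O) (Nf Ng : nat) (chif chig : int -> algC) (af ag : nat -> algC).
Variables (rhof rhog : GQ -> 'M[O]_2) (cyc phi : GQ -> O).
Variables (c : set algC) (phi0 : set algC -> algC).
Hypotheses (rhofP : is_lattice_of p pi e Nf chif af rhof)
  (rhogP : is_lattice_of p pi e Ng chig ag rhog)
  (cycP : is_cyclotomic p cyc) (phiP : is_padic_avatar p d pi e c phi0 phi).
Local Notation act := (M_rep rhof rhog phi cyc).

Lemma twist_conj_mul s t : GK d s -> GK d t ->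
  twist_conj phi (Defs.gal_mul s t) = twist_conj phi s * twist_conj phi t.
Proof.
move=> Ks Kt; rewrite /twist_conj -(av_mul phiP); try exact: GK_conj.
by congr phi; apply: GQ_ext => x /=; rewrite conjCK.
Qed.

Lemma twist_conj_continuous k (s : GQ) : GK d s -> exists X : seq algC, forall t, GK d t ->
  {in X, s =1 t} -> adic pi (V := O^o) k (twist_conj phi t - twist_conj phi s).
Proof.
move=> Ks; have [X XP] := av_cont phiP k (GK_conj Ks).
exists [seq x^* | x <- X] => t Kt st; apply: XP; first exact: GK_conj.
by move=> x Xx /=; rewrite st //; apply: map_f.
Qed.

Lemma M_rep_one v : act Defs.gal_one v = v.
Proof.
rewrite /= /M_act (rho_one rhofP) (rho_one rhogP) trmx1 mul1mx mulmx1.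
rewrite (cyclotomic_one cycP) expr1n mulr1 /twist_conj.
have -> : Defs.gal_mul complex_conj (Defs.gal_mul Defs.gal_one complex_conj) = Defs.gal_one.
  by apply: GQ_ext => x /=; rewrite conjCK.
by rewrite (av_one phiP) scale1r.
Qed.

Lemma M_rep_mul s t v : GK d s -> GK d t ->
  act (Defs.gal_mul s t) v = act s (act t v).
Proof.
move=> Ks Kt; rewrite /= /M_act (rho_mul rhofP) (rho_mul rhogP) trmx_mul.
rewrite twist_conj_mul // (cyclotomic_mul cycP) -scalemxAr -scalemxAl scalerA !mulmxA.
by congr (_ *: _); ring.
Qed.

Lemma M_rep_continuous k v (s : GQ) : GK d s -> exists X : seq algC, forall t, GK d t ->
  {in X, s =1 t} -> adic pi k (act t v - act s v).
Proof.
move=> Ks.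
have [X1 X1P] := twist_conj_continuous k Ks.
have [X2 X2P] := cyclotomic_continuous cycP k s.
have [X3 X3P] := rho_cont rhofP k (s := s) I.
have [X4 X4P] := rho_cont rhogP k (s := s) I.
exists (X1 ++ X2 ++ X3 ++ X4) => t Kt st; apply/adic_mxP => i j.
have sub : forall X : seq algC, {subset X <= X1 ++ X2 ++ X3 ++ X4} -> {in X, s =1 t}.
  by move=> X sX x /sX /st.
have {}X1P := X1P t Kt (sub X1 ltac:(by move=> x xX; rewrite !mem_cat xX)).
have {}X2P := X2P t (sub X2 ltac:(by move=> x xX; rewrite !mem_cat xX orbT)).
have {}X3P := X3P t I (sub X3 ltac:(by move=> x xX; rewrite !mem_cat xX !orbT)).
have {}X4P := X4P t I (sub X4 ltac:(by move=> x xX; rewrite !mem_cat xX !orbT)).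
have entry (A B : 'M[O]_2) : adic pi k (A - B) -> forall i j, adic pi (V := O^o) k (A i j - B i j).
  by move=> /adic_mxP AB i' j'; have := AB i' j'; rewrite !mxE.
have adic_sum (f g : 'I_2 -> O) : (forall l, adic pi (V := O^o) k (f l - g l)) ->
    adic pi (V := O^o) k (\sum_l f l - \sum_l g l).
  move=> fg; rewrite -sumrB; elim/big_ind: _ => [|x y|l _]; [exact: adic0|exact: adicD|exact: fg].
have refl (x : O) : adic pi (V := O^o) k (x - x) by rewrite subrr; apply: adic0.
rewrite /= /M_act !mxE; apply: adicM.
  by apply: adicM => //; rewrite !expr2; apply: adicM.
apply: (adic_sum) => l; rewrite !mxE; apply: adicM; last exact: (entry).
by apply: (adic_sum) => l'; apply: adicM => //; apply: entry.
Qed.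

End TensorModule.
End GaloisModule.

(** * The nebentypus at p, and the assembly of the result *)

(** By Euler, [p ^ totient N] is 1 modulo [N], so chi(p) is a root of unity. As [e] is
    multiplicative on [E] only, powers are tracked together with their membership in [E]. *)
Lemma dirichlet_char_unit (N p d : nat) (chi : int -> algC) (O : idomainType)
    (E : set algC) (e : algC -> O) : (0 < N)%N -> (0 < p)%N -> coprime p N ->
  dirichlet_char N chi -> is_embedding d E e -> (forall x, E (chi x)) ->
  e (chi p%:Z) \is a GRing.unit.
Proof.
move=> N_gt0 p_gt0 pN chiP eP E_chi.
have chi1 : chi 1 = 1.
  have chi1_neq0 : chi 1 != 0 by rewrite (chi_support chiP) /coprimez gcd1z.
  by apply: (mulIf chi1_neq0); rewrite -(chi_mul chiP) !mul1r.
have chi_period_nat q : chi (1 + q%:Z * N%:Z) = 1.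
  elim: q => [|q IH]; first by rewrite mul0r addr0.
  by rewrite -IH -(chi_period chiP (1 + q%:Z * N%:Z)); congr chi; rewrite intS; ring.
have chiX n : chi (p ^ n.+1)%N%:Z = chi p%:Z ^+ n.+1.
  elim: n => [|n IH]; first by rewrite expn1 expr1.
  by rewrite expnS PoszM (chi_mul chiP) IH -exprS.
have eX n : e (chi p%:Z) ^+ n.+1 = e (chi p%:Z ^+ n.+1).
  suff [_ ->] : E (chi p%:Z ^+ n.+1) /\ e (chi p%:Z) ^+ n.+1 = e (chi p%:Z ^+ n.+1) by [].
  elim: n => [|n [En IH]]; first by rewrite !expr1.
  split; first by rewrite exprS; apply: (E_mul eP).
  by rewrite exprS IH [in RHS]exprS (e_mul eP).
have t_gt0 : (0 < totient N)%N by rewrite totient_gt0.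
have chi_order : e (chi p%:Z) ^+ totient N = 1.
  rewrite -(prednK t_gt0) eX -chiX prednK //.
  have /eqP := Euler_exp_totient pN; rewrite eqn_mod_dvd ?expn_gt0 ?p_gt0 //.
  case/dvdnP => q Eq.
  have -> : (p ^ totient N)%N%:Z = 1 + q%:Z * N%:Z.
    have p_pow_gt0 : (0 < p ^ totient N)%N by rewrite expn_gt0 p_gt0.
    by rewrite -PoszM -Eq; lia.
  by rewrite chi_period_nat (e_one eP).
apply/unitrP; exists (e (chi p%:Z) ^+ (totient N).-1).
by rewrite -exprS -exprSr prednK.
Qed.

Theorem theorem4p10
  (* the prime p, the field K = Q(sqrt(-d)), the integers N and m *)
  (p : nat) (p_prime : prime p) (p_odd : odd p)
  (d : nat) (d_sqf : square_free d) (p_splits : splits d p)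
  (h : nat) (h_class : class_number d h) (p_ndvd_h : ~~ (p %| h)%N)
  (N : nat) (N_gt0 : (0 < N)%N) (pN : coprime p N)
  (m : nat) (m_sqf : square_free m)
  (m_primes : forall l, prime l -> (l %| m)%N ->
    coprime l (N * p) /\ splits d l)
  (* the ring class field H of conductor m and the field Km = K[m] *)
  (H Km : set algC) (H_ring_class : is_ring_class_field d m H)
  (Km_max : is_max_p_subextension p (QK d) H Km)
  (* the coefficient ring O, with maximal ideal generated by pi *)
  (O : idomainType) (pi : O) (O_padic : padic_integers p pi)
  (E : set algC) (e : algC -> O) (e_emb : is_embedding d E e)
  (* the eigenforms f and g *)
  (R : realType) (iota : {rmorphism algC -> R[i]})
  (Nf Ng : nat) (NfN : (Nf %| N)%N) (NgN : (Ng %| N)%N)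
  (chif chig : int -> algC) (af ag : nat -> algC)
  (f_eigen : is_eigenform2 iota Nf chif af)
  (g_eigen : is_eigenform2 iota Ng chig ag)
  (E_af : forall n, E (af n)) (E_ag : forall n, E (ag n))
  (E_chif : forall x, E (chif x)) (E_chig : forall x, E (chig x))
  (g_nonordinary : adic pi (V := O^o) 1 (e (ag p)))
  (* the Hecke character and its p-adic avatar *)
  (c : set algC) (phi0 : set algC -> algC)
  (phi0_hecke : is_hecke_char p d pi e c phi0)
  (E_phi0 : forall I, nonzero_ideal (OK d) I ->
    coprime_ideals I (ideal_mul c (frakp d pi e)) -> E (phi0 I))
  (phi : GQ -> O) (phi_avatar : is_padic_avatar p d pi e c phi0 phi)
  (* the G_K-module M *)
  (rhof rhog : GQ -> 'M[O]_2)
  (rhof_lattice : is_lattice_of p pi e Nf chif af rhof)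
  (rhog_lattice : is_lattice_of p pi e Ng chig ag rhog)
  (cyc : GQ -> O) (cyc_cyclotomic : is_cyclotomic p cyc)
  (kac : GQ -> oneZp p_prime) (kac_anticyclotomic : is_anticyclotomic d e kac)
  (H0_trivial : residual_H0_trivial pi (GK d) (M_rep rhof rhog phi cyc))
  (* the classes kappa_n for n >= 1; kappa 0 is not used *)
  (kappa : forall n, H1n pi (M_rep rhof rhog phi cyc) kac (fixer Km) n)
  (kappa_rel : forall n,
    pr (kappa n.+3) =
      scale (e (ag p))%:P (kappa n.+2)
      - scale (e (chig p%:Z))%:P (Tr (kappa n.+1))) :
  exists! ks : H1oo pi (M_rep rhof rhog phi cyc) kac (fixer Km)
               * H1oo pi (M_rep rhof rhog phi cyc) kac (fixer Km),
    forall n,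
      (kappa n.+2, - scale (e (chig p%:Z))%:P (Tr (kappa n.+1))) =
        mat_act (Cg_prod p (e (ag p)) (e (chig p%:Z)) n.+1)
          (pr_oo n.+2 ks.1, pr_oo n.+2 ks.2).
Proof.
(* K[m]/K is Galois of p-power degree, as the vanishing of H^0 over K[m] requires; and since K[m]
   contains K, the laws valid on G_K restrict to its Galois group. *)
have [[k Km_galois] _ _] := Km_max; have [_ QK_Km _ _] := Km_galois.
have G_GK s : fixer Km s -> GK d s by move=> Gs x /QK_Km /Gs.
have chi_unit : e (chig p%:Z) \is a GRing.unit.
  apply: dirichlet_char_unit (ef_level g_eigen) (prime_gt0 p_prime) _
    (ef_char g_eigen) e_emb E_chig.
  exact: coprime_dvdr NgN pN.
have a_pi : exists b, e (ag p) = pi * b.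
  by have [b ->] := g_nonordinary; exists b; rewrite expr1.
have act_one := M_rep_one p_prime O_padic rhof_lattice rhog_lattice cyc_cyclotomic phi_avatar.
have GK_act_mul s t v (Ks : GK d s) (Kt : GK d t) :=
  M_rep_mul p_prime O_padic rhof_lattice rhog_lattice cyc_cyclotomic phi_avatar v Ks Kt.
have act_mul s t v : fixer Km s -> fixer Km t ->
    M_rep rhof rhog phi cyc (Defs.gal_mul s t) v =
    M_rep rhof rhog phi cyc s (M_rep rhof rhog phi cyc t v).
  by move=> /G_GK Ks /G_GK Kt; apply: GK_act_mul.
have act_cont j v s : fixer Km s -> exists X : seq algC, forall t, fixer Km t ->
    {in X, s =1 t} -> adic pi j (M_rep rhof rhog phi cyc t v - M_rep rhof rhog phi cyc s v).
  move=> /G_GK Ks.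
  have [X XP] := M_rep_continuous p_prime O_padic rhof_lattice rhog_lattice
    cyc_cyclotomic phi_avatar j v Ks.
  by exists X => t /G_GK Kt; apply: XP.
have GK_kac_mul := kac_mul kac_anticyclotomic.
have kac_mul n s t : fixer Km s -> fixer Km t ->
    kac (Defs.gal_mul s t) n = (kac s n * kac t n)%g.
  by move=> /G_GK Ks /G_GK Kt; apply: GK_kac_mul.
have kac_cont n s : fixer Km s -> exists X : seq algC, forall t, fixer Km t ->
    {in X, s =1 t} -> kac t n = kac s n.
  move=> /G_GK Ks; have [X XP] := kac_cont kac_anticyclotomic n Ks.
  by exists X => t /G_GK Kt; apply: XP.
have H0_levels n (x : LV p_prime 'M[O]_2 n) := LV_H0_trivial p_odd O_padic Km_galois
  act_one GK_act_mul GK_kac_mul H0_trivial (f := x).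
have [ks ksP] := decomposition_exists p_odd O_padic chi_unit a_pi (@fixer_mul Km)
  act_mul kac_mul act_cont kac_cont kappa_rel.
exists ks; split=> // ks' ksP'.
exact: (decomposition_unique p_odd O_padic chi_unit a_pi H0_levels ksP ksP').
Qed.
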